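(* Let $\mathcal{L}\subset \mathbb{P}^{2}_{\mathbb{R}}$ be an $M$-arrangement of $d$ lines that is not a pencil. Then $\mathcal{L}$ is simplicial and it has one of the following three weak combinatorics: $$(d;n_{2},n_{3},n_{4}) \in \{(5;4,0,1),(9;6,4,3),(13;12,4,9)\}.$$
   Context: A line arrangement of $d$ lines is a finite set of $d$ distinct lines in the projective plane. An intersection point is $k$-fold if exactly $k$ lines of the arrangement pass through it; $n_k$ denotes the number of $k$-fold intersection points. The vector $(d;n_2,n_3,n_4)$ is the weak combinatorics of an arrangement all of whose intersection points have multiplicity at most $4$. A pencil is an arrangement in which all lines pass through one common point. $M$-arrangement (also: $M$-line arrangement): an arrangement of $d$ lines in $\mathbb{P}^2_{\mathbb{C}}$ all of whose intersection points have multiplicity $2$, $3$ or $4$ (not all of these need occur), such that either $d=2m+1\geq 5$ is odd and $$n_2+4n_3+9n_4=3m^2+1,$$ or $d=2m\geq 4$ is even and $$n_2+4n_3+9n_4=3m^2-3m+3.$$ A real arrangement in $\mathbb{P}^2_{\mathbb{R}}$ is regarded as a complex one via $\mathbb{R}\subset\mathbb{C}$ (same linear forms). A real arrangement $\mathcal{L}\subset\mathbb{P}^2_{\mathbb{R}}$ is simplicial if all connected components of the complement $\mathbb{P}^2_{\mathbb{R}}\setminus\bigcup_{H\in\mathcal{L}}H$ are open $2$-simplices (open triangles). *)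

(* Defs.v *)
From HB Require Import structures.
From mathcomp Require Import all_boot all_order all_algebra finmap.
From mathcomp Require Import generic_quotient complex.
From mathcomp Require Import all_classical all_reals topology normedtype.

Set Implicit Arguments.
Unset Strict Implicit.
Unset Printing Implicit Defensive.

Import Order.TTheory GRing.Theory Num.Theory.
Import numFieldNormedType.Exports.

Local Open Scope classical_set_scope.
Local Open Scope ring_scope.
Local Open Scope quotient_scope.
Local Open Scope fset_scope.

Definition nzvec (F : fieldType) : Type := {v : 'rV[F]_3 | v != 0}.

HB.instance Definition _ (F : fieldType) := Choice.on (nzvec F).
HB.instance Definition _ (R : realType) :=
  Topological.copy (nzvec R)
    (initial_topology (fun u : nzvec R => sval u : 'rV[R]_3)).

Definition same_span (F : fieldType) (u v : nzvec F) : bool :=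
  (sval u == sval v)%MS.

Lemma same_span_equiv (F : fieldType) : equiv_class_of (@same_span F).
Proof.
split=> [u | u v | v u w]; rewrite /same_span.
- exact/eqmxP.
- by apply/eqmxP/eqmxP => /eqmx_sym.
- by move=> /eqmxP uv /eqmxP vw; apply/eqmxP; exact: eqmx_trans uv vw.
Qed.

Canonical same_span_rel (F : fieldType) :=
  EquivRelPack (same_span_equiv F).

Definition pplane (F : fieldType) : Type := {eq_quot (@same_span_rel F)}.

HB.instance Definition _ (F : fieldType) := Choice.on (pplane F).
HB.instance Definition _ (F : fieldType) := Quotient.on (pplane F).
HB.instance Definition _ (F : fieldType) := EqQuotient.on (pplane F).

Definition coords (F : fieldType) (P : pplane F) : 'rV[F]_3 := sval (repr P).

Lemma coords_neq0 (F : fieldType) (P : pplane F) : coords P != 0.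
Proof. exact: svalP (repr P). Qed.

Lemma coords_pi (F : fieldType) (u : nzvec F) :
  (coords (\pi_(pplane F) u) :=: sval u)%MS.
Proof. by apply/eqmxP; apply/(@eqmodP _ (same_span_rel F)); rewrite reprK. Qed.

Lemma coords_inj (F : fieldType) (P Q : pplane F) :
  (coords P == coords Q)%MS -> P = Q.
Proof.
by move=> h; rewrite -[P]reprK -[Q]reprK; apply/(@eqmodP _ (same_span_rel F)).
Qed.

(* A line is given by the coefficients, up to a nonzero scalar, of a nonzero
   linear form, i.e. by a point of the dual plane. *)
Definition pline (F : fieldType) : Type := pplane F.

HB.instance Definition _ (F : fieldType) := Choice.on (pline F).

Definition on_line (F : fieldType) (P : pplane F) (l : pline F) : bool :=
  coords P *m (coords l)^T == 0.

Definition arrangement (F : fieldType) : Type := {fset pline F}.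

Lemma on_line_pi (F : fieldType) (u v : nzvec F) :
  on_line (\pi_(pplane F) u) (\pi_(pplane F) v) =
  (sval u *m (sval v)^T == 0).
Proof.
have H m n p (a : 'M[F]_(m, p)) (b : 'M_(n, p)) q (c : 'M_(p, q)) :
    (a :=: b)%MS -> (a *m c == 0) = (b *m c == 0).
  by move=> ab; rewrite -!sub_kermx ab.
rewrite /on_line (H _ _ _ _ _ _ _ (coords_pi u)).
rewrite -trmx_eq0 trmx_mul trmxK (H _ _ _ _ _ _ _ (coords_pi v)).
by rewrite -trmx_eq0 trmx_mul trmxK.
Qed.

Lemma two_lines_meet_once (F : fieldType) (P Q : pplane F) (l1 l2 : pline F) :
  l1 != l2 -> on_line P l1 -> on_line P l2 -> on_line Q l1 -> on_line Q l2 ->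
  P = Q.
Proof.
move=> ne P1 P2 Q1 Q2; apply: coords_inj.
have r1 (S : pplane F) : \rank (coords S) = 1%N.
  by rewrite rank_rV coords_neq0.
have rB : (1 < \rank (coords l1 + coords l2)%MS)%N.
  rewrite ltnNge; apply: contra ne => rB; apply/eqP/coords_inj.
  have h (l : pline F) : (coords l <= coords l1 + coords l2)%MS ->
      (coords l == coords l1 + coords l2)%MS.
    by move=> lB; rewrite -(geq_leqif (mxrank_leqif_eq lB)) r1.
  have /eqmxP h1 := h _ (addsmxSl _ _); have /eqmxP h2 := h _ (addsmxSr _ _).
  by apply/eqmxP; apply: eqmx_trans h1 (eqmx_sym h2).
pose K := kermx (coords l1 + coords l2)%MS^T.
have rK : (\rank K <= 1)%N.
  rewrite mxrank_ker mxrank_tr.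
  by move: rB; case: (\rank _) => [|[|n]] // _; rewrite subSS leq_subLR addn1.
have sub (S : pplane F) : on_line S l1 -> on_line S l2 -> (coords S == K)%MS.
  move=> S1 S2; have SK : (coords S <= K)%MS.
    apply/sub_kermxP; rewrite -[LHS]trmxK trmx_mul trmxK.
    apply/eqP; rewrite trmx_eq0 -sub_kermx addsmx_sub !sub_kermx.
    by rewrite -[X in X && _]trmx_eq0 -[X in _ && X]trmx_eq0 !trmx_mul !trmxK;
       apply/andP.
  by rewrite -(geq_leqif (mxrank_leqif_eq SK)) r1.
have /eqmxP PK := sub _ P1 P2; have /eqmxP QK := sub _ Q1 Q2.
by apply/eqmxP; apply: eqmx_trans PK (eqmx_sym QK).
Qed.

Section Combinatorics.
Variables (F : fieldType) (A : arrangement F).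

Definition multiplicity (P : pplane F) : nat :=
  #|` [fset l in A | on_line P l] |.

Definition kfold_points (k : nat) : set (pplane F) :=
  [set P | multiplicity P = k].

Lemma kfold_points_finite (k : nat) : (2 <= k)%N -> finite_set (kfold_points k).
Proof.
move=> k2.
have [-> //|/set0P[P0 _]] := eqVneq (kfold_points k) set0.
pose meet (p : pline F * pline F) : pplane F :=
  xget P0 [set P | on_line P p.1 && on_line P p.2].
apply: (@sub_finite_set _ _ (meet @` [set` (A `*` A)])); last first.
  by apply: finite_image; exact: finite_fset.
move=> P /= Pk.
have : (1 < #|` [fset l in A | on_line P l] |)%N
  by rewrite -/(multiplicity P) Pk.
set B := [fset l in A | on_line P l] => B2.
have /fset0Pn[l1 B1] : B != fset0 by rewrite -cardfs_gt0 ltnW.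
have /fset0Pn[l2] : B `\ l1 != fset0.
  by rewrite -cardfs_gt0; move: B2; rewrite (cardfsD1 l1) B1.
rewrite in_fsetD1 eq_sym => /andP[ne].
move: B1; rewrite !inE /= => /andP[A1 P1] /andP[A2 P2].
exists (l1, l2); first by rewrite /= in_fsetM A1 A2.
have [Q1 Q2] : on_line (meet (l1, l2)) l1 /\ on_line (meet (l1, l2)) l2.
  by apply/andP; apply: (@xgetPex _ P0 [set P | on_line P l1 && on_line P l2]);
     exists P; rewrite /= P1 P2.
exact: two_lines_meet_once ne Q1 Q2 P1 P2.
Qed.

(* [fset_set] is only meaningful on finite sets: see [kfold_points_finite]. *)
Definition nfold (k : nat) : nat := #|` fset_set (kfold_points k) |.

Definition pencil : Prop := exists P, forall l, l \in A -> on_line P l.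

Definition weak_combinatorics : nat * nat * nat * nat :=
  (#|` A |, nfold 2, nfold 3, nfold 4).

End Combinatorics.

Definition M_arrangement (R : rcfType) (A : arrangement R[i]) : Prop :=
  let d := #|` A | in
  let s := (nfold A 2 + 4 * nfold A 3 + 9 * nfold A 4)%N in
  (forall P, (2 <= multiplicity A P)%N -> (multiplicity A P <= 4)%N) /\
  exists m : nat,
    [/\ d = (2 * m + 1)%N, (5 <= d)%N & s = (3 * m ^ 2 + 1)%N] \/
    [/\ d = (2 * m)%N, (4 <= d)%N & s = (3 * m ^ 2 - 3 * m + 3)%N].

Section Complexification.
Variable R : rcfType.

Lemma complexify_vec_proof (v : nzvec R) :
  map_mx (real_complex R) (sval v) != 0.
Proof. by rewrite map_mx_eq0; exact: svalP v. Qed.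

Definition complexify_vec (v : nzvec R) : nzvec R[i] :=
  exist _ (map_mx (real_complex R) (sval v)) (complexify_vec_proof v).

Definition complexify_line (l : pline R) : pline R[i] :=
  \pi_(pplane R[i]) (complexify_vec (repr (l : pplane R))).

Definition complexify (A : arrangement R) : arrangement R[i] :=
  [fset complexify_line l | l in A].

End Complexification.

Section Simplicial.
Variables (R : realType) (A : arrangement R).

(* The points of a set of the form {[a u + b v + c w] | a, b, c > 0}, where
   u, v, w are the rows of the invertible matrix M: one of the four open
   triangles cut out by the three lines joining [u], [v] and [w]. *)
Definition open_triangle (M : 'M[R]_3) : set (pplane R) :=
  [set P | exists2 c : 'rV[R]_3,
     forall j, 0 < c 0 j & (coords P == c *m M)%MS].

Definition complement : set (pplane R) :=
  [set P | forall l, l \in A -> ~~ on_line P l].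

Definition simplicial : Prop :=
  forall P, complement P ->
    exists2 M : 'M[R]_3, M \in unitmx &
      @connected_component (quotient_topology (pplane R)) complement P
        = open_triangle M.

End Simplicial.

(* Main.v *)
(* Write m = (d - 1) / 2 or d / 2. The defining equation of an M-arrangement and the
   count of pairs of lines express n_2 and n_3 through m and n_4; Melchior's
   inequality n_2 >= 3 + n_4 then leaves twelve weak combinatorics. In the three of
   the statement it is an equality, and equality means that all regions are
   triangles. The other nine are excluded by counting the double, triple and 4-fold
   points on each line, by Melchior's inequality for subarrangements (obtained by
   deleting one line, or three concurrent ones) and for the arrangement dual to the
   4-fold points, and, for (11; 10, 3, 6), by an argument on affine maps of the real
   line.

   Melchior's inequality comes from double counting pairs of a region and a side:
   a region of an arrangement that is not a pencil has at least three sides. Regions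
   are encoded by the signs of the linear forms at their points, and counted by
   deletion and restriction. *)

Require Import Defs.
From mathcomp Require Import all_boot all_order all_algebra boolp.
From mathcomp Require Import zify ring lra.

Set Implicit Arguments.
Unset Strict Implicit.
Unset Printing Implicit Defensive.

Import Order.TTheory GRing.Theory Num.Theory.

Local Open Scope ring_scope.

(** * Sign vectors of a central arrangement *)

(** Lifting everything to vectors of a three-dimensional space replaces Euler's formula by linear
    algebra. A projective region becomes a pair of opposite sign vectors, which explains the factors
    2 and 4 in the counts. Topology enters only at the end, to identify classes of sign vectors with
    connected components.

    The total surplus of walls over three per region equals, up to constants, the defect in
    Melchior's inequality. A single identity, [sum_excess], thus yields both the inequality and its
    equality case. In that case a region is given by three inequalities without a common zero, that
    is, by a simplicial cone.

    A configuration is a pair of families of vectors. The same inequality therefore applies to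
    subsets of the lines, the points being kept fixed, and to points regarded as lines. This matters
    because the nine spurious combinatorics all satisfy the global inequality, three of them with
    equality, so only finer incidence information can exclude them. *)

Definition dot (R : fieldType) (u v : 'rV[R]_3) : R := (u *m v^T) 0 0.

Section Dot.
Variable R : fieldType.
Implicit Types u v w : 'rV[R]_3.

Lemma dot_eq0 u v : (dot u v == 0) = (u *m v^T == 0).
Proof.
apply/eqP/eqP => [h|h]; last by rewrite /dot h mxE.
by apply/rowP=> j; rewrite ord1 -[LHS]/(dot u v) h mxE.
Qed.

Lemma dotC u v : dot u v = dot v u.
Proof. by rewrite /dot -(trmxK (u *m _)) trmx_mul trmxK mxE. Qed.

Lemma dotDr u v w : dot u (v + w) = dot u v + dot u w.
Proof. by rewrite /dot linearD mulmxDr mxE. Qed.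

Lemma dotZr u a v : dot u (a *: v) = a * dot u v.
Proof. by rewrite /dot linearZ -scalemxAr mxE. Qed.

Lemma dotNr u v : dot u (- v) = - dot u v.
Proof. by rewrite -scaleN1r dotZr mulN1r. Qed.

Lemma dotBr u v w : dot u (v - w) = dot u v - dot u w.
Proof. by rewrite dotDr dotNr. Qed.

Lemma exists_dot_separate u v :
  ~~ (u <= v)%MS -> exists2 w, dot v w = 0 & dot u w != 0.
Proof.
rewrite submxE => /rV0Pn[j]; set c := cokermx v => h.
exists (col j c)^T; first by rewrite /dot trmxK colE mulmxA mulmx_coker mul0mx mxE.
by rewrite /dot trmxK colE mulmxA -colE mxE.
Qed.

Lemma exists_dot_neq0 u : u != 0 -> exists w, dot u w != 0.
Proof.
move=> u0; have h : ~~ (u <= (0 : 'rV[R]_3))%MS.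
  by apply: contra u0 => /sub_rVP[a ->]; rewrite scaler0.
by have [w _ uw] := exists_dot_separate h; exists w.
Qed.

(** Two independent forms on a three-dimensional space have a one-dimensional common kernel. This
    gives both the uniqueness of the meeting point of two lines and, dually, of the line joining two
    points. *)
Lemma common_kernel_scale u v (x y : 'rV[R]_3) : ~~ (u <= v)%MS -> v != 0 ->
  (x : 'rV_3) != 0 -> dot u x = 0 -> dot v x = 0 -> dot u y = 0 -> dot v y = 0 ->
  exists c, y = c *: x.
Proof.
move=> uv v0 x0 ux vx uy vy; apply/sub_rVP.
pose K := kermx (col_mx u v)^T.
have r2 : (2 <= \rank (col_mx u v))%N.
  have : (\rank v < \rank (u + v)%MS)%N.
    rewrite ltn_neqAle mxrankS ?addsmxSr // andbT.
    rewrite (mxrank_leqif_eq (addsmxSr u v)).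
    apply: contra uv => /eqmxP /eqmx_sym h; rewrite -h; exact: addsmxSl.
  by rewrite rank_rV v0 addsmxE.
have rK : (\rank K <= 1)%N.
  rewrite mxrank_ker mxrank_tr; move: r2; case: (\rank _) => [|[|?]] // _.
  by rewrite subSS leq_subLR addn1.
have sub z : dot u z = 0 -> dot v z = 0 -> (z <= K)%MS.
  move=> uz vz; apply/sub_kermxP; rewrite -[LHS]trmxK trmx_mul trmxK mul_col_mx.
  apply/eqP; rewrite trmx_eq0 col_mx_eq0 -!dot_eq0 uz vz; exact/andP.
have xK := sub _ ux vx; have yK := sub _ uy vy.
have h : (x == K)%MS by rewrite -(geq_leqif (mxrank_leqif_eq xK)) rank_rV x0.
by rewrite (eqmxP h).
Qed.
End Dot.

Section Topes.
Variables (R : realFieldType) (I : finType) (n : I -> 'rV[R]_3).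
Implicit Types (J K S U : {set I}) (x y w : 'rV[R]_3).

Lemma exists_dot_gt0 (u : 'rV[R]_3) : u != 0 -> exists w, 0 < dot u w.
Proof.
move=> /exists_dot_neq0[w]; case: (ltrgt0P (dot u w)) => // h _; first by exists w.
by exists (- w); rewrite dotNr oppr_gt0.
Qed.

Lemma small_enough (P : I -> R -> Prop) :
  (forall i, exists2 e0, 0 < e0 & forall e, 0 < e -> e <= e0 -> P i e) ->
  exists2 e, 0 < e & forall i, P i e.
Proof.
move=> H.
suff [e0 e00 h] : exists2 e0, 0 < e0 &
    forall e, 0 < e -> e <= e0 -> forall i, i \in enum I -> P i e.
  by exists e0 => // i; apply: h => //; rewrite mem_enum.
elim: (enum I) => [|i s [e1 e10 IH]]; first by exists 1.
have [e2 e20 h2] := H i; exists (Num.min e1 e2); first by rewrite lt_min e10.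
move=> e e0; rewrite le_min => /andP[ee1 ee2] j; rewrite inE => /orP[/eqP->|js].
  exact: h2.
exact: IH.
Qed.

Lemma perturb x w : exists2 e, 0 < e & forall i, dot (n i) x != 0 ->
  Num.sg (dot (n i) (x + e *: w)) = Num.sg (dot (n i) x) /\
  Num.sg (dot (n i) (x - e *: w)) = Num.sg (dot (n i) x).
Proof.
apply: small_enough => i; set a := dot _ x; set b := dot (n i) w.
have [->|a0] := eqVneq a 0; first by exists 1.
have b1 : 0 < 1 + `|b| by rewrite ltr_wpDr.
(* The summand 1 covers the case [b = 0] and makes the estimate of [e * b] strict. *)
exists (`|a| / (1 + `|b|)) => [|e e0]; first by rewrite divr_gt0 ?normr_gt0.
rewrite ler_pdivlMr // => h _; rewrite dotBr dotDr dotZr -/a -/b.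
have {h b1} : `|e * b| < `|a|.
  by rewrite normrM (gtr0_norm e0); apply: lt_le_trans h; rewrite mulrDr mulr1 ltrDr.
move: (e * b) => c; rewrite ltr_norml.
have [a1|a1|//] := ltrgt0P a; last by move/eqP: a0.
  by move=> /andP[h1 h2]; rewrite !gtr0_sg //; lra.
by move=> /andP[h1 h2]; rewrite !ltr0_sg //; lra.
Qed.

Definition pos J x := [set j in J | 0 < dot (n j) x].

(* The sign vectors on [J] of the points of the subspace cut out by [K], a sign
   vector being encoded by its set of positive indices. *)
Definition tope J K S := exists x,
  [/\ {in K, forall k, dot (n k) x = 0}, {in J, forall j, dot (n j) x != 0}
    & S = pos J x].

Definition topes J K := [set S | `[< tope J K S >]].

Lemma topesP J K S : reflect (tope J K S) (S \in topes J K).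
Proof. by rewrite inE; exact: asboolP. Qed.

Lemma topes0 K : topes set0 K = [set set0].
Proof.
apply/setP=> S; rewrite in_set1; apply/topesP/eqP => [[x [_ _ ->]]|->].
  by apply/setP=> i; rewrite !inE.
exists 0; split=> [k _|j|]; rewrite ?inE //.
  by rewrite -(scale0r (0 : 'rV_3)) dotZr mul0r.
by apply/setP=> i; rewrite !inE.
Qed.

Lemma tope_sub J K S : S \in topes J K -> S \subset J.
Proof. by move=> /topesP[x [_ _ ->]]; apply/subsetP=> i; rewrite inE => /andP[]. Qed.

Lemma pos_eq J x y : {in J, forall j, (0 < dot (n j) x) = (0 < dot (n j) y)} ->
  pos J x = pos J y.
Proof.
by move=> h; apply/setP=> j; rewrite !inE; case: (boolP (j \in J)) => // jJ; rewrite h.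
Qed.

Lemma perturb_tope J x w : {in J, forall j, dot (n j) x != 0} ->
  exists2 e, 0 < e & forall y, y = x + e *: w \/ y = x - e *: w ->
    {in J, forall j, dot (n j) y != 0} /\ pos J y = pos J x.
Proof.
move=> xJ; have [e e0 h] := perturb x w; exists e => // y hy.
have sg j : j \in J -> Num.sg (dot (n j) y) = Num.sg (dot (n j) x).
  by move=> /xJ /h[h1 h2]; case: hy => ->.
split; first by move=> j jJ; rewrite -sgr_eq0 sg // sgr_eq0 xJ.
by apply: pos_eq => j jJ; rewrite -sgr_gt0 sg // sgr_gt0.
Qed.

Lemma posU1 J i x : pos (i |: J) x = if 0 < dot (n i) x then i |: pos J x else pos J x.
Proof.
case: ifPn => h; apply/setP=> j; rewrite !inE; have [->|ji] := eqVneq j i; rewrite ?h //.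
by rewrite (negbTE h) !andbF.
Qed.

(** A point on [i] can be pushed slightly off to either side along [w], without changing its signs
    on [J] and without leaving the subspace cut out by [K]. *)
Lemma lift_tope J K S i w : (forall k, k \in K -> dot (n k) w = 0) ->
  0 < dot (n i) w -> S \in topes J (i |: K) ->
  S \in topes (i |: J) K /\ i |: S \in topes (i |: J) K.
Proof.
move=> wK wi /topesP[x [xK xJ ->]].
have [e e0 h] := perturb_tope w xJ.
have xi : dot (n i) x = 0 by apply: xK; rewrite setU11.
have xK' k : k \in K -> dot (n k) x = 0 by move=> kK; apply: xK; rewrite setU1r.
have ew : 0 < e * dot (n i) w by rewrite mulr_gt0.
have [hp1 hp2] := h _ (or_introl erefl); have [hm1 hm2] := h _ (or_intror erefl).
split; apply/topesP; [exists (x - e *: w) | exists (x + e *: w)]; split.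
- by move=> k kK; rewrite dotBr dotZr xK' // wK // mulr0 subr0.
- move=> j /setU1P[->|]; last exact: hm1.
  by rewrite dotBr dotZr xi sub0r oppr_eq0 gt_eqF.
- by rewrite posU1 dotBr dotZr xi sub0r oppr_gt0 ltNge ltW //= hm2.
- by move=> k kK; rewrite dotDr dotZr xK' // wK // mulr0 addr0.
- move=> j /setU1P[->|]; last exact: hp1.
  by rewrite dotDr dotZr xi add0r gt_eqF.
- by rewrite posU1 dotDr dotZr xi add0r ew hp2.
Qed.

Lemma drop_tope J K S i : i \notin J -> S \in topes (i |: J) K -> S :\ i \in topes J K.
Proof.
move=> iJ /topesP[x [xK xJ ->]]; apply/topesP; exists x; split=> //.
  by move=> j jJ; apply: xJ; rewrite setU1r.
apply/setP=> j; rewrite !inE; have [->|//] := eqVneq j i.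
by rewrite (negbTE iJ).
Qed.

(* The segment joining two points on either side of [i] meets [i]. *)
Lemma cross_tope J K S i : i \notin J -> i \notin S ->
  S \in topes (i |: J) K -> i |: S \in topes (i |: J) K -> S \in topes J (i |: K).
Proof.
move=> iJ iS /topesP[x [xK xJ hx]] /topesP[y [yK yJ hy]].
have ix := xJ i (setU11 _ _); have iy := yJ i (setU11 _ _).
have xi : dot (n i) x < 0.
  rewrite lt_neqAle ix /= leNgt; apply/negP => h.
  by move: iS; rewrite hx inE setU11 h.
have yi : 0 < dot (n i) y.
  by have := setU11 i S; rewrite hy inE => /andP[].
have same j : j \in J -> (0 < dot (n j) x) = (0 < dot (n j) y).
  move=> jJ; have ji : j != i by apply: contraNneq iJ => <-.
  have : (j \in S) = (j \in i |: S) by rewrite in_setU1 (negbTE ji).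
  by rewrite {1}hx hy !inE jJ orbT.
set a := dot (n i) x in xi *; set b := dot (n i) y in yi *.
(* Since [a < 0 < b], this is a positive combination of [x] and [y]; the coefficients make it vanish
   on [i]. *)
pose z := b *: x - a *: y.
have zj j : dot (n j) z = b * dot (n j) x - a * dot (n j) y.
  by rewrite dotBr !dotZr.
apply/topesP; exists z; split.
- move=> k /setU1P[->|kK]; rewrite zj -/a -/b; first by rewrite mulrC subrr.
  by rewrite xK // yK // !mulr0 subrr.
- move=> j jJ; rewrite zj; have := same j jJ.
  have := xJ j (setU1r _ jJ); have := yJ j (setU1r _ jJ).
  move: (dot _ x) (dot _ y) => p q q0 p0.
  case: (ltrgt0P p) p0 => // hp _; case: (ltrgt0P q) q0 => // hq _ _.
    by rewrite gt_eqF //; nra.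
  by rewrite lt_eqF //; nra.
- have -> : S = pos J x.
    rewrite hx posU1 ltNge ltW //=.
  apply: pos_eq => j jJ; rewrite zj; have := same j jJ.
  have := xJ j (setU1r _ jJ); have := yJ j (setU1r _ jJ).
  move: (dot _ x) (dot _ y) => p q q0 p0.
  case: (ltrgt0P p) p0 => // hp _; case: (ltrgt0P q) q0 => // hq _ _.
    by apply/esym; nra.
  by apply/esym/negbTE; rewrite -leNgt; nra.
Qed.

(** Every sign vector of [J] extends to at least one side of [i], and to both exactly when it is
    realized on [i] itself. So [Xm] and [Xp] have the sign vectors of the deletion as their union
    and those of the restriction as their intersection. The vector [w] witnesses that [i] does not
    vanish on the whole subspace cut out by [K]. *)
Lemma deletion_restriction J K i w : i \notin J ->
  {in K, forall k, dot (n k) w = 0} -> dot (n i) w != 0 ->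
  #|topes (i |: J) K| = (#|topes J K| + #|topes J (i |: K)|)%N.
Proof.
move=> iJ.
wlog wi : w / 0 < dot (n i) w => [hw wK wi|wK _].
  case: (ltrgt0P (dot (n i) w)) wi => // wi _; first by apply: (hw w); rewrite ?gt_eqF.
  apply: (hw (- w)); rewrite ?dotNr ?oppr_gt0 ?oppr_eq0 ?lt_eqF // => k kK.
  by rewrite dotNr wK ?oppr0.
set T := topes (i |: J) K.
pose Xm := [set S in topes J K | S \in T]; pose Xp := [set S in topes J K | i |: S \in T].
have notin S : S \in topes J K -> i \notin S.
  by move=> /tope_sub /subsetP h; apply: contra iJ; exact: h.
have -> : T = Xm :|: [set i |: S | S in Xp].
  apply/setP=> S; apply/idP/setUP => [ST|[|/imsetP[S']]]; last 2 first.
  - by rewrite inE => /andP[].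
  - by rewrite inE => /andP[_ h] ->.
  have d := drop_tope iJ ST.
  case: (boolP (i \in S)) => iS; [right|left].
    by apply/imsetP; exists (S :\ i); rewrite ?setD1K // inE d setD1K.
  have E : S :\ i = S by apply/setDidPl; rewrite disjoint_sym disjoints1.
  by rewrite inE ST andbT -E.
rewrite cardsU (_ : _ :&: _ = set0) ?cards0 ?subn0; last first.
  apply/setP=> S; rewrite in_setI in_set0; apply/negP => /andP[].
  rewrite inE => /andP[/notin iS _] /imsetP[S' _ E].
  by move: iS; rewrite E setU11.
rewrite card_in_imset; last first.
  move=> S S'; rewrite !inE => /andP[h _] /andP[h' _] E.
  have iS : i \notin S by apply: notin; rewrite inE.
  have iS' : i \notin S' by apply: notin; rewrite inE.
  by rewrite -(setU1K iS) E setU1K.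
rewrite addnC -cardsUI; congr addn; congr #|pred_of_set _|; apply/setP=> S.
- apply/setUP/idP => [h|ST]; first by case: h; rewrite inE => /andP[].
  have /topesP[x [xK xJ Sx]] := ST.
  have [e e0 h] := perturb_tope w xJ.
  have [a0|a0] := eqVneq (dot (n i) x) 0.
    have ST' : S \in topes J (i |: K).
      by apply/topesP; exists x; split=> // k /setU1P[->|/xK].
    by right; have [h1 _] := lift_tope wK wi ST'; rewrite inE ST h1.
  have xT : pos (i |: J) x \in T.
    by apply/topesP; exists x; split=> // j /setU1P[->|/xJ].
  move: xT; rewrite posU1 -Sx; case: ifP => _ h1; [left|right];
    by rewrite inE ST.
- rewrite in_setI [S \in Xp]inE [S \in Xm]inE.
  apply/idP/idP => [/andP[/andP[ST S1] /andP[_ S2]]|ST].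
    by apply: cross_tope => //; exact: notin.
  have [h1 h2] := lift_tope (J := J) wK wi ST.
  have ST' : S \in topes J K.
    have /topesP[x [xK xJ Sx]] := ST.
    by apply/topesP; exists x; split=> // k kK; apply: xK; rewrite setU1r.
  by rewrite ST' h1 h2.
Qed.
End Topes.

(** * Melchior's inequality *)

Definition incident (R : fieldType) (I Pt : Type) (n : I -> 'rV[R]_3)
  (v : Pt -> 'rV[R]_3) (i : I) (p : Pt) : bool := dot (n i) (v p) == 0.

(** Every meeting point of two lines is among the points, but a point need not be a meeting point.
    Both families are plain vectors, so that lines and points can exchange roles in the dual
    arrangement. *)
Record configuration (R : fieldType) (I Pt : eqType) (n : I -> 'rV[R]_3)
    (v : Pt -> 'rV[R]_3) : Prop := Configuration {
  line_neq0 : forall i, n i != 0;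
  point_neq0 : forall p, v p != 0;
  line_sep : forall i j, i != j -> ~~ (n i <= n j)%MS;
  point_sep : forall p q, p != q -> ~~ (v p <= v q)%MS;
  line_meet : forall i j, i != j -> exists2 p, incident n v i p & incident n v j p }.

Arguments line_sep {R I Pt n v} _ [i j].
Arguments point_sep {R I Pt n v} _ [p q].
Arguments line_meet {R I Pt n v} _ [i j].

Section Melchior.
Variables (R : realFieldType) (I Pt : finType).
Variables (n : I -> 'rV[R]_3) (v : Pt -> 'rV[R]_3).
Hypothesis C : configuration n v.
Local Notation inc := (incident n v).
Implicit Types (i j : I) (p q : Pt) (J K S U : {set I}).
Local Notation topes := (topes n).

Lemma meet_uniq i j p q : i != j -> inc i p -> inc j p -> inc i q -> inc j q -> p = q.
Proof.
move=> ij /eqP ip /eqP jp /eqP iq /eqP jq.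
apply/eqP/contraT => /(point_sep C); apply: contraNT => _.
have [c ->] :=
  common_kernel_scale (line_sep C ij) (line_neq0 C j) (point_neq0 C q) iq jq ip jp.
exact: scalemx_sub.
Qed.

Definition mult_in J p := #|[set i in J | inc i p]|.

Lemma multU1 J i p : i \notin J -> mult_in (i |: J) p = (inc i p + mult_in J p)%N.
Proof.
move=> iJ; rewrite /mult_in; case: (boolP (inc i p)) => ip.
  transitivity #|i |: [set i in J | inc i p]|; last by rewrite cardsU1 inE (negbTE iJ).
  congr #|pred_of_set _|; apply/setP=> j; rewrite !inE.
  by have [->|] := eqVneq j i; rewrite ?ip.
congr #|pred_of_set _|.
by apply/setP=> j; rewrite !inE; have [->|] := eqVneq j i; rewrite ?(negbTE ip) ?andbF.
Qed.

Lemma mult_gt0 J p : reflect (exists2 i, i \in J & inc i p) (0 < mult_in J p)%N.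
Proof.
rewrite /mult_in card_gt0; apply: (iffP (set0Pn _)) => [[j]|[i iJ ip]].
  by rewrite inE => /andP[]; exists j.
by exists i; rewrite inE iJ.
Qed.

(** The forms [i] and [j] cut out the line spanned by [v p]. Away from the origin it consists of two
    opposite rays, and both are lost once a form of [J] vanishes at [p]. If [J] is empty, only the
    empty sign vector remains. *)
Lemma card_topes_point J i j p : i != j -> inc i p -> inc j p ->
  #|topes J [set i; j]| = if (0 < mult_in J p)%N then 0%N else if J == set0 then 1%N else 2%N.
Proof.
move=> ij ip jp.
have H S : S \in topes J [set i; j] ->
    exists c, [/\ {in J, forall m, c * dot (n m) (v p) != 0} & S = pos n J (c *: v p)].
  move=> /topesP[x [xK xJ ->]].
  have [||c E] := common_kernel_scale (line_sep C ij) (line_neq0 C j)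
    (point_neq0 C p) (eqP ip) (eqP jp) (y := x).
  - by apply: xK; rewrite !inE eqxx.
  - by apply: xK; rewrite !inE eqxx orbT.
  by rewrite E in xJ *; exists c; split=> // m /xJ; rewrite dotZr.
case: mult_gt0 => [[m mJ mp]|h].
  apply/eqP; rewrite cards_eq0 -subset0; apply/subsetP=> S /H[c [cJ _]].
  by have := cJ m mJ; rewrite (eqP mp) mulr0 eqxx.
have [->|J0] := eqVneq J set0; first by rewrite topes0 cards1.
have nz m : m \in J -> dot (n m) (v p) != 0.
  by move=> mJ; apply/negP => mp; apply: h; exists m.
have vK k : k \in [set i; j] -> dot (n k) (v p) = 0.
  by rewrite !inE => /orP[] /eqP->; apply/eqP.
have -> : topes J [set i; j] = [set pos n J (v p); pos n J (- v p)].
  apply/setP=> S; rewrite in_set2; apply/idP/orP => [/H[c [cJ ->]]|[] /eqP->]; last 2 first.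
  - by apply/topesP; exists (v p).
  - apply/topesP; exists (- v p); split=> // [k kK|m mJ].
      by rewrite dotNr vK ?oppr0.
    by rewrite dotNr oppr_eq0 nz.
  have [m mJ] := set0Pn _ J0; have := cJ _ mJ; rewrite mulf_eq0 negb_or => /andP[c0 _].
  case: (ltrgt0P c) c0 => // hc _; [left|right]; apply/eqP/pos_eq => l lJ.
    by rewrite dotZr pmulr_rgt0.
  by rewrite dotZr dotNr nmulr_rgt0 // oppr_gt0.
rewrite cards2; case: eqP => // E; exfalso.
have [m mJ] := set0Pn _ J0.
have : (m \in pos n J (v p)) = (m \in pos n J (- v p)) by rewrite E.
by rewrite !inE mJ dotNr oppr_gt0 /=; have := nz _ mJ; case: ltrgt0P.
Qed.

Lemma set_indU1 (P : {set I} -> Prop) : P set0 ->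
  (forall i J, i \notin J -> P J -> P (i |: J)) -> forall J, P J.
Proof.
move=> P0 PU J; move: {2}#|J| (erefl #|J|) => m; elim: m J => [|m IH] J hm.
  by rewrite (cards0_eq hm).
have [i iJ] : exists i, i \in J by apply/set0Pn; rewrite -card_gt0 hm.
rewrite -(setD1K iJ); apply: PU; first by rewrite !inE eqxx.
by apply: IH; move: hm; rewrite (cardsD1 i) iJ => -[].
Qed.

Definition line_points J i := [set p | inc i p & (0 < mult_in J p)%N].

(** In the plane cut out by [i], each point of [J] on [i] is a line through the origin, and k such
    lines leave 2k sectors when k is positive. *)
Lemma card_topes_line J i : i \notin J -> J != set0 ->
  #|topes J [set i]| = (2 * #|line_points J i|)%N.
Proof.
elim/set_indU1: J => [|j J jJ IH]; first by rewrite eqxx.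
rewrite in_setU1 negb_or => /andP[ij iJ] _.
have [p ip jp] := line_meet C ij.
have [w wi wj] : exists2 w, dot (n i) w = 0 & dot (n j) w != 0.
  by apply: exists_dot_separate; apply: (line_sep C); rewrite eq_sym.
rewrite (deletion_restriction (w := w) jJ) //; last by move=> k /set1P->.
rewrite (card_topes_point J (p := p)) 1?eq_sym //.
have -> : line_points (j |: J) i = p |: line_points J i.
  apply/setP=> q; rewrite !inE multU1 //; have [->|qp] := eqVneq q p.
    by rewrite ip jp.
  case: (boolP (inc i q)) => //= iq; case: (boolP (inc j q)) => //= jq.
  by rewrite (meet_uniq ij ip jp iq jq) eqxx in qp.
rewrite cardsU1 inE ip /=.
have [->|J0] := eqVneq J set0.
  have m0 q : mult_in set0 q = 0%N.
    by apply/eqP; rewrite cards_eq0; apply/eqP/setP=> l; rewrite !inE.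
  rewrite topes0 cards1 m0 /= [line_points _ _](_ : _ = set0) ?cards0 //.
  by apply/setP=> q; rewrite !inE m0 andbF.
by rewrite IH //; case: (0 < mult_in J p)%N => /=; lia.
Qed.

Lemma mult0 p : mult_in set0 p = 0%N.
Proof. by apply/eqP; rewrite cards_eq0; apply/eqP/setP=> l; rewrite !inE. Qed.

(** A line added to a nonempty arrangement creates one region for each old point on it, and these
    are exactly the points where the truncated predecessor grows. The outer factor 2 counts a cone
    together with its opposite. *)
Lemma card_topes J : J != set0 ->
  #|topes J set0| = (2 * (1 + \sum_p (mult_in J p).-1))%N.
Proof.
elim/set_indU1: J => [|j J jJ IH]; first by rewrite eqxx.
move=> _; have [w wj] := exists_dot_neq0 (line_neq0 C j).
rewrite (deletion_restriction (w := w) jJ) //; last by move=> k; rewrite inE.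
rewrite setU0.
have [->|J0] := eqVneq J set0.
  rewrite !topes0 !cards1 big1 // => p _.
  by rewrite multU1 ?inE // mult0 addn0; case: inc.
rewrite IH // card_topes_line // -mulnDr -addnA; congr (2 * (1 + _))%N.
rewrite -sum1_card [X in (_ + X)%N]big_mkcond -big_split; apply: eq_bigr => p _ /=.
by rewrite multU1 // inE; case: inc; case: (mult_in J p) => [|m]; rewrite /= ?addn0 ?addn1.
Qed.

(** A line is a wall when the signs of the region on the other lines are attained on the line
    itself, so that the region has a side there. *)
Definition walls J S := [set i in J | S :\ i \in topes (J :\ i) [set i]].

(** A line with k multiple points carries k segments, hence 2k opposite sectors, and each sector
    borders two cones. Summing 4k over the lines counts each multiple point once per line through
    it. *)
Lemma sum_walls J : (1 < #|J|)%N ->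
  (\sum_(S in topes J set0) #|walls J S| = 4 * \sum_(p | 1 < mult_in J p) mult_in J p)%N.
Proof.
move=> J1.
transitivity (\sum_(i in J) 4 * #|[set p | inc i p & (1 < mult_in J p)%N]|)%N; last first.
  rewrite -big_distrr /=; congr (4 * _)%N.
  under eq_bigr do rewrite -sum1_card big_mkcond.
  rewrite exchange_big [RHS]big_mkcond; apply: eq_bigr => p _ /=.
  case: ifP => hp; last by rewrite big1 // => i _; rewrite inE hp andbF.
  rewrite /mult_in -sum1_card big_mkcond [RHS]big_mkcond; apply: eq_bigr => i _.
  by rewrite !inE hp andbT; case: (i \in J).
transitivity (\sum_(i in J) #|[set S in topes J set0 | S :\ i \in topes (J :\ i) [set i]]|)%N.
  under eq_bigr do rewrite -sum1_card big_mkcond.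
  rewrite exchange_big [RHS]big_mkcond; apply: eq_bigr => i _ /=.
  case: (boolP (i \in J)) => iJ; last first.
    by rewrite big1 // => S _; rewrite inE (negbTE iJ).
  rewrite -sum1_card big_mkcond [RHS]big_mkcond; apply: eq_bigr => S _.
  rewrite !in_set iJ /=.
  by case: `[< _ >].
apply: eq_bigr => i iJ.
have iJ' : i \notin J :\ i by rewrite !inE eqxx.
have J0 : J :\ i != set0 by rewrite -card_gt0; move: J1; rewrite (cardsD1 i) iJ.
have -> : [set p | inc i p & (1 < mult_in J p)%N] = line_points (J :\ i) i.
  apply/setP=> p; rewrite !inE -{1}(setD1K iJ) multU1 //.
  by case: inc.
rewrite (_ : 4 * _ = 2 * (2 * #|line_points (J :\ i) i|))%N; last by rewrite mulnA.
rewrite -card_topes_line //; set T := topes _ [set i].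
have notin S : S \in T -> i \notin S.
  by move=> /tope_sub /subsetP h; apply: contra iJ'; exact: h.
have [w wi] := exists_dot_gt0 (line_neq0 C i).
have -> : [set S in topes J set0 | S :\ i \in T] = T :|: [set i |: S | S in T].
  have lift S : S \in T -> S \in topes J set0 /\ i |: S \in topes J set0.
    move=> ST; rewrite -(setD1K iJ); apply: lift_tope wi _; last by rewrite setU0.
    by move=> k; rewrite inE.
  apply/setP=> S; rewrite in_setU; apply/idP/orP => [|[ST|/imsetP[S' S'T ->]]].
  - rewrite inE => /andP[_ ST]; case: (boolP (i \in S)) => iS; [right|left].
      by apply/imsetP; exists (S :\ i); rewrite ?setD1K.
    have E : S :\ i = S by apply/setDidPl; rewrite disjoint_sym disjoints1.
    by rewrite -E.
  - have E : S :\ i = S by apply/setDidPl; rewrite disjoint_sym disjoints1 notin.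
    by rewrite inE E ST (lift _ ST).1.
  - by rewrite inE (lift _ S'T).2 setU1K // notin.
rewrite cardsU (_ : _ :&: _ = set0) ?cards0 ?subn0; last first.
  apply/setP=> S; rewrite in_setI in_set0; apply/negP => /andP[/notin iS].
  by move=> /imsetP[S' _ E]; move: iS; rewrite E setU11.
rewrite card_in_imset ?addnn ?mul2n //.
by move=> S S' /notin iS /notin iS' E; rewrite -(setU1K iS) E setU1K.
Qed.

(** Moving inside the plane of [i] removes the accidental zeros of the other forms one at a time, by
    steps too small to alter a nonzero sign. *)
Lemma generic_on_line J i z : dot (n i) z = 0 -> exists z',
  [/\ dot (n i) z' = 0,
      forall l, dot (n l) z != 0 -> Num.sg (dot (n l) z') = Num.sg (dot (n l) z)
    & {in J :\ i, forall j, dot (n j) z' != 0}].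
Proof.
move=> iz; elim/set_indU1: J => [|j J jJ [z' [iz' sgz' Jz']]].
  by exists z; split=> // j; rewrite !inE andbF.
have [->|ji] := eqVneq j i.
  exists z'; split=> // l; rewrite !inE => /andP[li]; rewrite (negbTE li) => lJ.
  by apply: Jz'; rewrite !inE li.
have [jz'|jz'] := eqVneq (dot (n j) z') 0; last first.
  exists z'; split=> // l; rewrite !inE => /andP[li /predU1P[-> //|lJ]].
  by apply: Jz'; rewrite !inE li.
have [w wi wj] := exists_dot_separate (line_sep C ji).
have [e e0 h] := perturb n z' w.
exists (z' + e *: w); split.
- by rewrite dotDr dotZr iz' wi mulr0 addr0.
- by move=> l lz; rewrite (h _ _).1 ?sgz' // -sgr_eq0 sgz' // sgr_eq0.
- move=> l; rewrite !inE => /andP[li /predU1P[->|lJ]].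
    by rewrite dotDr dotZr jz' add0r mulf_neq0 // gt_eqF.
  have lz' : dot (n l) z' != 0 by apply: Jz'; rewrite !inE li.
  by rewrite -sgr_eq0 (h _ lz').1 sgr_eq0.
Qed.

Definition agree U x y := forall i, i \in U -> 0 < dot (n i) x * dot (n i) y.

Definition determines J U x := forall y, agree U x y -> agree J x y.

Lemma mulr_gt0_sg (a b c : R) : Num.sg b = Num.sg c -> (0 < a * b) = (0 < a * c).
Proof. by move=> h; rewrite -sgr_gt0 sgrM h -sgrM sgr_gt0. Qed.

(* An inequality in a minimal determining system cannot be dropped, so it is
   tight along a facet of the region. *)
Lemma determining_walls J x : {in J, forall j, dot (n j) x != 0} ->
  exists U, U \subset walls J (pos n J x) /\ determines J U x.
Proof.
move=> xJ; pose P U := (U \subset J) && `[< determines J U x >].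
have [|U /minsetP[/andP[UJ /asboolP dU] minU]] := @ex_minset _ P.
  by exists J; rewrite /P subxx; apply/asboolP.
exists U; split=> //; apply/subsetP=> i iU; have iJ := subsetP UJ _ iU.
(* By minimality, dropping [i] admits a point that satisfies all the other inequalities of [U] and
   fails the one at [i]. *)
have [y [yU yi]] : exists y, agree (U :\ i) x y /\ dot (n i) x * dot (n i) y <= 0.
  apply: contrapT => no; have : U :\ i = U; last first.
    by move/setP/(_ i); rewrite !inE eqxx iU.
  apply: minU; last exact: subD1set.
  rewrite /P (subset_trans (subD1set _ _) UJ); apply/asboolP => y yU.
  apply: dU => l lU; have [->|li] := eqVneq l i; last by apply: yU; rewrite !inE li.
  by rewrite ltNge; apply/negP => h; apply: no; exists y.
set a := dot (n i) x in yi; set b := dot (n i) y in yi.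
have a0 : a != 0 := xJ _ iJ.
(* The point where the segment from [x] to [y] meets [i], up to a scalar: the coefficient of [y] is
   positive and that of [x] is nonnegative, because [a * b <= 0]. *)
pose z := a ^+ 2 *: y - (a * b) *: x.
have iz : dot (n i) z = 0 by rewrite dotBr !dotZr -/a -/b; ring.
have zU l : l \in U :\ i -> 0 < dot (n l) x * dot (n l) z.
  move=> /yU h; rewrite dotBr !dotZr.
  have a2 : 0 < a ^+ 2 by rewrite exprn_even_gt0.
  have : 0 <= (dot (n l) x) ^+ 2 by rewrite sqr_ge0.
  move: (dot _ x) (dot _ y) (a ^+ 2) (a * b) a2 h yi => p q r t; nra.
have [z' [iz' sgz' Jz']] := generic_on_line J iz.
(* The point [z'] lies on [i], so [dU] does not apply to it. A small move towards [x] restores the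
   sign at [i] and keeps the others. *)
have z'J j : j \in J :\ i -> 0 < dot (n j) x * dot (n j) z'.
  move=> jJi; have [e e0 h] := perturb n z' x.
  have jJ : j \in J by move: jJi; rewrite !inE => /andP[].
  rewrite (mulr_gt0_sg _ (esym (h _ (Jz' _ jJi)).1)); apply: dU jJ => l lU.
  have [->|li] := eqVneq l i.
    by rewrite dotDr dotZr iz' add0r mulrCA -/a mulr_gt0 // -expr2 exprn_even_gt0.
  have lUi : l \in U :\ i by rewrite !inE li.
  have lz0 : dot (n l) z != 0.
    by apply/eqP=> E; have := zU _ lUi; rewrite E mulr0 ltxx.
  rewrite (mulr_gt0_sg _ (_ : _ = Num.sg (dot (n l) z))) ?zU //.
  by rewrite (h _ _).1 ?sgz' // -sgr_eq0 sgz' // sgr_eq0.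
rewrite inE iJ; apply/topesP; exists z'; split=> //.
  by move=> k /set1P->.
apply/setP=> j; rewrite !inE; have [->//|ji] := eqVneq j i.
case: (boolP (j \in J)) => //= jJ.
have := z'J j; rewrite !inE ji => /(_ jJ); have := xJ j jJ.
case: (ltrgt0P (dot (n j) x)) => // hx _; first by rewrite pmulr_rgt0 // => ->.
by rewrite nmulr_rgt0 // => h; rewrite [in RHS]ltNge ltW.
Qed.

Definition nonpencil J := forall u, u != 0 -> exists2 j, j \in J & dot (n j) u != 0.

(** If all of [U] vanished at [u] but some [j] in [J] did not, one could move from [x] along [u]
    until reaching [j] without changing any sign on [U]. *)
Lemma determining_span J U x : {in J, forall j, dot (n j) x != 0} -> nonpencil J ->
  U \subset J -> determines J U x -> nonpencil U.
Proof.
move=> xJ npJ UJ dU u u0; apply: contrapT => no.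
have [j jJ ju] := npJ u u0.
have Uu i : i \in U -> dot (n i) u = 0.
  by move=> iU; apply/eqP; apply/negPn/negP => h; apply: no; exists i.
have := dU (x - (dot (n j) x / dot (n j) u) *: u) _ j jJ.
rewrite dotBr dotZr divfK // subrr mulr0 ltxx => /(_ _)/notF; apply.
move=> i iU; rewrite dotBr dotZr (Uu i iU) mulr0 subr0 -expr2 exprn_even_gt0 //=.
exact: xJ (subsetP UJ _ iU).
Qed.

Lemma nonpencil_card U : nonpencil U -> (3 <= #|U|)%N.
Proof.
move=> npU; rewrite leqNgt; apply/negP => U3.
pose A := \matrix_(i < #|U|) n (enum_val i).
have : kermx A^T != 0.
  rewrite -mxrank_eq0 mxrank_ker mxrank_tr subn_eq0 -ltnNge.
  exact: leq_ltn_trans (rank_leq_row A) U3.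
case/rowV0Pn => u /sub_kermxP uA u0; have [i iU] := npU u u0.
rewrite dotC dot_eq0 => /eqP[]; have := congr1 (col (enum_rank_in iU i)) uA.
rewrite colE -mulmxA -colE -tr_row rowK enum_rankK_in // => ->.
by apply/colP=> l; rewrite !mxE.
Qed.

Lemma nonpencil_gt1 J : nonpencil J -> (1 < #|J|)%N.
Proof. by move/nonpencil_card; exact: ltnW. Qed.

Lemma walls_ge3 J S : nonpencil J -> S \in topes J set0 -> (3 <= #|walls J S|)%N.
Proof.
move=> npJ /topesP[x [_ xJ ->]]; have [U [UW dU]] := determining_walls xJ.
apply: leq_trans (subset_leq_card UW); apply: nonpencil_card.
apply: determining_span dU => //; apply: subset_trans UW _.
by apply/subsetP=> i; rewrite inE => /andP[].
Qed.

(** The weight of a k-fold point in Melchior's inequality. It is cut off below 2 because points of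
    the full configuration may cease to be multiple in a subarrangement. *)
Definition excess (k : nat) : int := if (k < 2)%N then 0 else 3 - k%:Z.

(** Both counts are sums over the points, so this is [2(3 - k) = 4k - 6(k - 1)] at each k-fold
    point. The right-hand side is 6 plus the surplus of walls over three per cone. *)
Lemma sum_excess J : nonpencil J ->
  2 * \sum_p excess (mult_in J p) =
  6 + (\sum_(S in topes J set0) #|walls J S|)%N%:Z - 3 * #|topes J set0|%:Z.
Proof.
move=> npJ; have J1 := nonpencil_gt1 npJ.
rewrite sum_walls // card_topes -?card_gt0 1?ltnW //.
have -> : \sum_p excess (mult_in J p) =
    2 * (\sum_(p | 1 < mult_in J p) mult_in J p)%N%:Z - 3 * (\sum_p (mult_in J p).-1)%N%:Z.
  rewrite !(big_morph Posz PoszD (erefl 0%:Z)) [X in 2 * X]big_mkcond /=.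
  rewrite 2!mulr_sumr -sumrB; apply: eq_bigr => p _.
  by rewrite /excess; case: (mult_in J p) => [|[|m]] //=; lia.
by lia.
Qed.

Lemma melchior J : nonpencil J -> 3 <= \sum_p excess (mult_in J p).
Proof.
move=> npJ; have E := sum_excess npJ.
suff : (3 * #|topes J set0| <= \sum_(S in topes J set0) #|walls J S|)%N by lia.
by rewrite mulnC -sum_nat_const; apply: leq_sum => S; exact: walls_ge3.
Qed.

Lemma melchior_eq J x : nonpencil J -> \sum_p excess (mult_in J p) = 3 ->
  {in J, forall j, dot (n j) x != 0} ->
  exists U, [/\ U \subset J, #|U| = 3%N, nonpencil U & determines J U x].
Proof.
move=> npJ E3 xJ; have E := sum_excess npJ.
have xT : pos n J x \in topes J set0.
  by apply/topesP; exists x; split=> // k; rewrite inE.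
(* A fourth wall of this one cone would make the total exceed three per cone, contradicting [E3]. *)
have w3 : #|walls J (pos n J x)| = 3%N.
  apply/eqP; rewrite eqn_leq walls_ge3 // andbT leqNgt; apply/negP => w4.
  suff : (3 * #|topes J set0| < \sum_(S in topes J set0) #|walls J S|)%N by lia.
  rewrite mulnC -sum_nat_const (bigD1 _ xT) [ltnRHS](bigD1 _ xT) /= -addSn.
  by rewrite leq_add //; apply: leq_sum => S /andP[ST _]; exact: walls_ge3.
have [U [UW dU]] := determining_walls xJ.
have UJ : U \subset J.
  by apply: subset_trans UW _; apply/subsetP=> i; rewrite inE => /andP[].
have npU := determining_span xJ npJ UJ dU.
exists U; split=> //; apply/eqP; rewrite eqn_leq nonpencil_card // andbT -w3.
exact: subset_leq_card.
Qed.

End Melchior.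

(** * Counting points on lines *)

Lemma sum_int (I : finType) (P : pred I) (F : I -> nat) :
  (\sum_(i | P i) F i)%N%:Z = \sum_(i | P i) (F i)%:Z.
Proof. exact: (big_morph Posz PoszD (erefl 0%:Z)). Qed.

Lemma card_sum_bool (I : finType) (P : pred I) : #|[set i | P i]| = (\sum_i P i)%N.
Proof.
by rewrite -sum1_card big_mkcond; apply: eq_bigr => i _; rewrite inE; case: (P i).
Qed.

Lemma exists_common_kernel (R : fieldType) (u v : 'rV[R]_3) :
  exists2 x, x != 0 & dot u x = 0 /\ dot v x = 0.
Proof.
have : kermx (col_mx u v)^T != 0.
  rewrite -mxrank_eq0 mxrank_ker mxrank_tr subn_eq0 -ltnNge.
  exact: leq_ltn_trans (rank_leq_row _) _.
case/rowV0Pn => x /sub_kermxP h x0; exists x => //.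
move: h; rewrite tr_col_mx mul_mx_row -[0]hsubmxK => /eq_row_mx[].
by rewrite !linear0 -[dot u x]dotC -[dot v x]dotC /dot => -> ->; rewrite mxE.
Qed.

(** An ordered pair of distinct elements lies in at most one [A m], so no pair of [J] is counted
    twice. *)
Lemma sum_pairs_le (M T : finType) (J : {set T}) (A : M -> {set T}) :
  (forall m, A m \subset J) ->
  (forall m m' p q, p != q -> p \in A m -> q \in A m -> p \in A m' -> q \in A m' -> m = m') ->
  (\sum_m #|A m| * #|A m|.-1 <= #|J| * #|J|.-1)%N.
Proof.
move=> AJ uniqA.
have E (B : {set T}) : (#|B| * #|B|.-1 = \sum_p \sum_q [&& p \in B, q \in B & p != q])%N.
  rewrite -sum_nat_const big_mkcond; apply: eq_bigr => p _.
  case: (boolP (p \in B)) => pB; last by rewrite big1.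
  rewrite (cardsD1 p B) pB /= -sum1_card big_mkcond; apply: eq_bigr => q _.
  by rewrite !inE andbC eq_sym; case: (_ && _).
rewrite E; under eq_bigr do rewrite E; rewrite exchange_big; apply: leq_sum => p _.
rewrite exchange_big; apply: leq_sum => q _ /=.
have [->|pq] := eqVneq p q; first by rewrite big1 // => i _; rewrite !andbF.
rewrite !andbT.
have [[m /andP[pm qm]]|no] := pselect (exists m, (p \in A m) && (q \in A m)); last first.
  rewrite big1 // => m _; rewrite andbT; apply/eqP; rewrite eqb0; apply/negP => h.
  by apply: no; exists m.
rewrite !(subsetP (AJ m)) // (bigD1 m) //= big1 ?addn0 ?leq_b1 // => m' mm'.
apply/eqP; rewrite andbT eqb0; apply: contra mm' => /andP[pm' qm'].
by rewrite (uniqA _ _ _ _ pq pm qm pm' qm').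
Qed.

(** For [c >= 2] the difference of the two sides is [(c - 3)(c - 4)], nonnegative at integers. For
    smaller [c] the truncated product is 0. *)
Lemma tangent_at_4 (c : nat) : (8 * c <= (c + 3) * (c - 2) + 18)%N.
Proof. case: c => [|[|[|[|c]]]] //; rewrite (_ : (c.+4 - 2 = c + 2)%N); [nia | lia]. Qed.

Section Counting.
Variables (R : realFieldType) (I Pt : finType).
Variables (n : I -> 'rV[R]_3) (v : Pt -> 'rV[R]_3).
Hypothesis C : configuration n v.
Local Notation inc := (incident n v).
Local Notation mult := (mult_in n v).
Implicit Types (i j : I) (p q : Pt) (J T : {set I}).

Let meet_same := meet_uniq C.

Lemma sum_mult_line J i : i \notin J -> (\sum_(p | inc i p) mult J p = #|J|)%N.
Proof.
move=> iJ; under eq_bigr => p _ do rewrite /mult_in -sum1_card big_mkcond.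
rewrite exchange_big -sum1_card [RHS]big_mkcond; apply: eq_bigr => j _ /=.
case: (boolP (j \in J)) => jJ; last first.
  by rewrite big1 // => p _; rewrite inE (negbTE jJ).
have ij : i != j by apply: contraNneq iJ => ->.
have [p ip jp] := line_meet C ij; rewrite (bigD1 p) //= inE jJ jp big1 // => q /andP[iq qp].
rewrite inE jJ /=; case: ifP => // jq.
by rewrite (meet_same ij ip jp iq jq) eqxx in qp.
Qed.

Definition nb (k : nat) := #|[set p | mult setT p == k]|.

Definition nb_on (k : nat) i := #|[set p | inc i p & mult setT p == k]|.

Lemma sum_nb_on k : (\sum_i nb_on k i = k * nb k)%N.
Proof.
under eq_bigr do rewrite /nb_on card_sum_bool.
rewrite exchange_big /nb -sum1_card big_distrr /= [RHS]big_mkcond.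
apply: eq_bigr => p _; rewrite inE; case: eqP => [<-|_].
  rewrite muln1 /mult_in card_sum_bool; apply: eq_bigr => i _.
  by rewrite inE andbT.
by rewrite big1 // => i _; rewrite andbF.
Qed.

Definition kpts (k : nat) : {set Pt} := [set p | mult setT p == k].

Lemma sum_nb_on_pairs k :
  (\sum_i nb_on k i * (nb_on k i).-1 <= nb k * (nb k).-1)%N.
Proof.
apply: sum_pairs_le => [i|i j p q pq]; first by apply/subsetP=> p; rewrite !inE => /andP[].
rewrite !inE => /andP[ip _] /andP[iq _] /andP[jp _] /andP[jq _].
by apply/eqP; apply: contraNT pq => ij; rewrite (meet_same ij ip jp iq jq).
Qed.

Hypothesis mult24 : forall p, (2 <= mult setT p <= 4)%N.

Lemma sum_by_mult (P : pred Pt) (g : nat -> int) :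
  \sum_(p | P p) g (mult setT p) =
    g 2%N * #|[set p | P p & mult setT p == 2%N]|%:Z +
    g 3%N * #|[set p | P p & mult setT p == 3%N]|%:Z +
    g 4%N * #|[set p | P p & mult setT p == 4%N]|%:Z.
Proof.
rewrite !card_sum_bool !sum_int !mulr_sumr -!big_split big_mkcond /=.
apply: eq_bigr => p _; case: (P p) => /=; last by rewrite !mulr0.
move: (mult24 p); case: (mult setT p) => [|[|[|[|[|m]]]]] //= _;
  by rewrite ?mulr1 ?mulr0 ?addr0 ?add0r.
Qed.

Lemma sum_excess_mult : \sum_p excess (mult setT p) = (nb 2)%:Z - (nb 4)%:Z.
Proof.
have /= -> := sum_by_mult xpredT excess; rewrite -!/(nb _) /excess /=.
ring.
Qed.

Lemma line_count i : (nb_on 2 i + 2 * nb_on 3 i + 3 * nb_on 4 i = #|I|.-1)%N.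
Proof.
have iT : i \notin setT :\ i by rewrite !inE eqxx.
have -> : #|I|.-1 = #|setT :\ i| by rewrite -cardsT (cardsD1 i) in_setT.
rewrite -(sum_mult_line iT); apply: (can_inj (@absz_nat)).
rewrite sum_int; transitivity (\sum_(p | inc i p) ((mult setT p).-1)%:Z).
  by rewrite (sum_by_mult _ (fun k => k.-1%:Z)) -!/(nb_on _ i) /=; lia.
apply: eq_bigr => p ip; congr Posz.
have E := multU1 n v p iT; rewrite setD1K ?in_setT // ip in E.
by rewrite E.
Qed.

(* At any other point of the deleted lines [T] the multiplicity drops by one; the
   last summand is the correction at [p], where it drops by [#|T|]. *)
Lemma excess_deletion T p : {in T, forall i, inc i p} ->
  \sum_q excess (mult (~: T) q) =
    (nb 2)%:Z - (nb 4)%:Z +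
    \sum_(i in T) ((nb_on 3 i)%:Z + (nb_on 4 i)%:Z - (nb_on 2 i)%:Z) +
    (excess (mult setT p - #|T|) - excess (mult setT p)
       - (if mult setT p == 2%N then -1 else 1) * #|T|%:Z).
Proof.
move=> Tp; pose s q : int := if mult setT q == 2%N then -1 else 1.
have multC q : mult (~: T) q = (mult setT q - mult T q)%N.
  rewrite /mult_in -cardsDS; last by apply/subsetP=> i; rewrite !inE => /andP[].
  by apply: eq_card => i; rewrite !inE; case: (i \in T); case: inc.
have multT q : q != p -> (mult T q <= 1)%N.
  move=> qp; apply/card_le1_eqP => i j; rewrite !inE => /andP[iT iq] /andP[jT jq].
  apply/eqP; apply: contraTT qp => ij; apply/negPn/eqP.
  by apply: (meet_same ij) => //; exact: Tp.
have -> : \sum_(i in T) ((nb_on 3 i)%:Z + (nb_on 4 i)%:Z - (nb_on 2 i)%:Z) =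
    \sum_q s q * (mult T q)%:Z.
  under [RHS]eq_bigr do rewrite /mult_in card_sum_bool sum_int mulr_sumr.
  rewrite exchange_big big_mkcond; apply: eq_bigr => i _ /=.
  case: (i \in T); last by rewrite big1 // => q _; rewrite mulr0.
  transitivity (\sum_(q | inc i q) s q); last first.
    by rewrite big_mkcond; apply: eq_bigr => q _; case: inc; rewrite ?mulr1 ?mulr0.
  by rewrite (sum_by_mult _ (fun k => if k == 2%N then -1 else 1)) -!/(nb_on _ i) /=; ring.
rewrite -sum_excess_mult -big_split /= (bigD1 p) // [in RHS](bigD1 p) //= -!addrA.
have Ep : mult T p = #|T|.
  by apply: eq_card => i; rewrite !inE; case: (boolP (i \in T)) => // /Tp ->.
rewrite Ep [X in _ = _ + (_ + X)]addrC !addrA; congr (_ + _).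
  by rewrite multC Ep -/(s p); ring.
apply: eq_bigr => q qp; rewrite multC.
move: (multT q qp) (mult24 q); rewrite /s /excess.
by case: (mult T q) => [|[|t]] // _; case: (mult setT q) => [|[|[|[|[|k]]]]].
Qed.

Lemma concurrent (u : 'rV[R]_3) J : u != 0 -> (1 < #|J|)%N ->
  {in J, forall j, dot (n j) u = 0} -> exists p, {in J, forall j, inc j p}.
Proof.
move=> u0 /card_gt1P[i [j [iJ jJ ij]]] Ju.
have [p ip jp] := line_meet C ij; exists p => l lJ.
have [c E] := common_kernel_scale (line_sep C ij) (line_neq0 C j) u0
  (Ju i iJ) (Ju j jJ) (eqP ip) (eqP jp).
by rewrite /incident E dotZr Ju // mulr0.
Qed.

Lemma nonpencil_ge5 J : (5 <= #|J|)%N -> nonpencil n J.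
Proof.
move=> J5 u u0; apply: contrapT => no.
have [||p Jp] := concurrent u0 (J := J); first exact: leq_trans J5.
  by move=> j jJ; apply/eqP/negPn/negP => h; apply: no; exists j.
have : (#|J| <= mult setT p)%N.
  by apply/subset_leq_card/subsetP=> j jJ; rewrite inE in_setT Jp.
by have := mult24 p; lia.
Qed.

(** Deleting [i] removes its double points and lowers its triple and 4-fold points by one, so
    Melchior's sum changes by -1, +1 and +1 respectively. At least five lines remain, too many for a
    pencil. *)
Lemma line_deletion i : (6 <= #|I|)%N ->
  (3 + nb 4 + nb_on 2 i <= nb 2 + nb_on 3 i + nb_on 4 i)%N.
Proof.
(* Any point of [i] can serve as the common point in [excess_deletion]; for a single line the
   correction there is zero. *)
move=> I6; have [p ip] : exists p, inc i p.
  have : (0 < #|[set~ i]|)%N by rewrite cardsC1; lia.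
  by rewrite card_gt0 => /set0Pn[j]; rewrite !inE eq_sym => /(line_meet C)[p]; exists p.
have np : nonpencil n (~: [set i]) by apply: nonpencil_ge5; rewrite cardsC1; lia.
have := melchior C np.
rewrite (excess_deletion (p := p)); last by move=> j /set1P->.
rewrite big_set1 cards1.
have : excess (mult setT p - 1) - excess (mult setT p) -
   (if mult setT p == 2%N then -1 else 1) * 1%:Z = 0.
  by have := mult24 p; case: (mult setT p) => [|[|[|[|[|k]]]]].
move=> ->; rewrite addr0.
move: (nb 2) (nb 4) (nb_on 2 i) (nb_on 3 i) (nb_on 4 i) => a b c d e.
lia.
Qed.

(** The lines joining two points, each encoded by the set of points on it, which yields a finite
    type. They are the points of the dual configuration. *)
Let span_set (Q : {set Pt}) :=
  `[< exists2 u : 'rV[R]_3, u != 0 & Q = [set p | dot u (v p) == 0] >] && (1 < #|Q|)%N.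

(* Melchior's inequality for the arrangement dual to the 4-fold points, the
   lines spanned by which are only partly known: those of the original
   arrangement are, and the others are controlled by counting pairs. *)
Lemma dual_melchior : nonpencil v (kpts 4) ->
  6 <= (nb 4 * (nb 4).-1)%N%:Z + 18 * #|I|%:Z - 32 * (nb 4)%:Z.
Proof.
move=> npJ; pose J := kpts 4.
have H (Q : {Q | span_set Q}) :
    exists u : 'rV[R]_3, u != 0 /\ val Q = [set p | dot u (v p) == 0].
  by have /andP[/asboolP[u]] := valP Q; exists u.
pose u Q := sval (cid (H Q)).
have u0 Q : u Q != 0 := (svalP (cid (H Q))).1.
have uE Q : val Q = [set p | dot (u Q) (v p) == 0] := (svalP (cid (H Q))).2.
have usep Q Q' : Q != Q' -> ~~ (u Q <= u Q')%MS.
  apply: contra => /sub_rVP[c Ec]; have c0 : c != 0.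
    by apply: contraNneq (u0 Q) => c0; rewrite Ec c0 scale0r.
  apply/eqP/val_inj; rewrite !uE; apply/setP=> p; rewrite !inE Ec.
  by rewrite ![dot _ (v p)]dotC dotZr mulf_eq0 (negbTE c0).
have umeet p q : p != q -> exists2 Q, incident v u p Q & incident v u q Q.
  move=> pq; have [w w0 [pw qw]] := exists_common_kernel (v p) (v q).
  have hQ : span_set [set p | dot w (v p) == 0].
    apply/andP; split; first by apply/asboolP; exists w.
    by apply/card_gt1P; exists p, q; rewrite !inE ![dot w _]dotC pw qw eqxx.
  exists (Sub _ hQ); rewrite /incident dotC.
    have : p \in val (Sub _ hQ : {Q | span_set Q}) by rewrite /= !inE dotC pw eqxx.
    by rewrite uE inE.
  have : q \in val (Sub _ hQ : {Q | span_set Q}) by rewrite /= !inE dotC qw eqxx.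
  by rewrite uE inE.
have M := melchior (Configuration (point_neq0 C) u0 (point_sep C) usep umeet) npJ.
(* [h k] is [k(k - 1)] minus twice the excess, so Melchior's inequality and the pair count bound its
   sum from above. Truncation makes [h] nonnegative, so unknown spanned lines can be ignored. *)
pose h k := ((k + 3) * (k - 2))%N.
have hE k : 2 * excess k + (h k)%:Z = (k * k.-1)%N%:Z.
  by rewrite /excess /h; case: k => [|[|k]] //=; nia.
pose A (Q : {Q | span_set Q}) := J :&: val Q.
have multA Q : mult_in v u J Q = #|A Q|.
  by apply: eq_card => p; rewrite !inE uE inE /incident dotC.
have P : (\sum_Q #|A Q| * #|A Q|.-1 <= nb 4 * (nb 4).-1)%N.
  apply: sum_pairs_le => [Q|Q Q' p q pq]; first exact: subsetIl.
  rewrite !in_setI !uE !inE => /andP[_ /eqP a] /andP[_ /eqP b] /andP[_ /eqP c] /andP[_ /eqP d].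
  apply/eqP/contraT => /usep; apply: contraNT => _.
  have [] // := common_kernel_scale (point_sep C pq) (point_neq0 C q) (u0 Q') (y := u Q);
    rewrite 1?dotC //.
  by move=> x ->; exact: scalemx_sub.
(* Only lines with at least two 4-fold points have nonzero [h], and distinct such lines are distinct
   spanned lines. *)
have L : (\sum_i h (nb_on 4 i) <= \sum_Q h #|A Q|)%N.
  apply: (@leq_trans
    (\sum_i \sum_(Q : {Q | span_set Q} | val Q == [set p | inc i p]) h #|A Q|)).
    apply: leq_sum => i _; case: (ltnP 1 (nb_on 4 i)) => ci; last first.
      by rewrite /h (_ : _ - 2 = 0)%N ?muln0 //; lia.
    have hQ : span_set [set p | inc i p].
      apply/andP; split; first by apply/asboolP; exists (n i); rewrite ?(line_neq0 C).
      apply: leq_trans ci _; apply: subset_leq_card; apply/subsetP=> p.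
      by rewrite !inE => /andP[].
    rewrite (bigD1 (Sub _ hQ)) //= -[X in (X <= _)%N]addn0 leq_add //.
    rewrite /A /= (_ : #|_| = nb_on 4 i) //; apply: eq_card => p.
    by rewrite !inE andbC.
  rewrite (exchange_big_dep xpredT) //=; apply: leq_sum => Q _.
  have [i|no] := pickP (fun i => val Q == [set p | inc i p]); last by rewrite big_pred0.
  move=> /eqP Qi; rewrite (bigD1 i) ?Qi //= big1 ?addn0 // => j /andP[/eqP Qj ji].
  have /andP[_ /card_gt1P[p [q [pQ qQ]]]] := valP Q.
  move=> pq; have /[!inE] ip : p \in [set p | inc i p] by rewrite -Qi.
  have /[!inE] iq : q \in [set p | inc i p] by rewrite -Qi.
  have /[!inE] jp : p \in [set p | inc j p] by rewrite -Qj -Qi.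
  have /[!inE] jq : q \in [set p | inc j p] by rewrite -Qj -Qi.
  by rewrite (meet_same ji jp ip jq iq) eqxx in pq.
have L2 : (8 * (4 * nb 4) <= \sum_i h (nb_on 4 i) + 18 * #|I|)%N.
  rewrite -sum_nb_on big_distrr [(18 * _)%N]mulnC -sum_nat_const -big_split.
  by apply: leq_sum => i _; exact: tangent_at_4.
have : 2 * (\sum_Q excess (mult_in v u J Q)) + (\sum_Q h #|A Q|)%N%:Z =
    (\sum_Q #|A Q| * #|A Q|.-1)%N%:Z.
  rewrite !sum_int mulr_sumr -big_split; apply: eq_bigr => Q _ /=.
  by rewrite multA hE.
move: M P L L2; rewrite -/J; move: (\sum_Q excess _) (\sum_Q h _)%N (\sum_i h _)%N.
move: (\sum_Q _)%N (nb 4 * _)%N => a b c d e; clear; lia.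
Qed.

End Counting.

(** * Exclusion of the other weak combinatorics *)

Lemma weak_combinatorics_cases (d n2 n3 n4 m : nat) :
  (2 * n2 + 6 * n3 + 12 * n4 = d * d.-1)%N -> (n4 + 3 <= n2)%N ->
  [/\ d = 2 * m + 1, 5 <= d & n2 + 4 * n3 + 9 * n4 = 3 * m ^ 2 + 1]%N \/
  [/\ d = 2 * m, 4 <= d & n2 + 4 * n3 + 9 * n4 = 3 * m ^ 2 - 3 * m + 3]%N ->
  (d, n2, n3, n4) \in
    [:: (5, 4, 0, 1); (9, 6, 4, 3); (13, 12, 4, 9);
        (7, 6, 1, 2); (9, 9, 1, 4); (10, 9, 0, 6); (11, 10, 3, 6);
        (11, 13, 0, 7); (12, 12, 0, 9); (13, 15, 1, 10); (15, 18, 1, 14);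
        (17, 22, 0, 19)]%N.
Proof.
set target := [:: _; _; _; _; _; _; _; _; _; _; _; _].
have conclude a b c : n3 = b -> n2 = a -> d = c ->
    (c, a, b, n4) \in target -> (d, n2, n3, n4) \in target by move=> -> -> ->.
move=> pairs mel [] [ed d5 M].
  have sq : (m ^ 2 = m * m)%N by [].
  have e3 : (n3 + 3 * n4 + m = m * m + 1)%N by rewrite ed addn1 /= in pairs; nia.
  have e2 : (n2 + m * m + 3 = 3 * n4 + 4 * m)%N by rewrite ed addn1 /= in pairs; nia.
  (* The bounds [2 n4 >= m^2 - 4m + 6] (Melchior) and [3 n4 <= m^2 - m + 1] ([n3 >= 0]) combine to
     [(m - 2)(m - 8) <= 0]. *)
  have m8 : (m <= 8)%N by nia.
  clear pairs M sq.
  have : [\/ m = 2 /\ n4 = 1, m = 3 /\ n4 = 2, m = 4 /\ n4 = 3 \/ m = 4 /\ n4 = 4 |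
      [\/ m = 5 /\ n4 = 6 \/ m = 5 /\ n4 = 7, m = 6 /\ n4 = 9 \/ m = 6 /\ n4 = 10,
          m = 7 /\ n4 = 14 | m = 8 /\ n4 = 19]]%N.
    move: m8 ed d5 e2 e3 mel; clear.
    case: m => [|[|[|[|[|[|[|[|[|m]]]]]]]]] m8 ed d5 e2 e3 mel;
      try by exfalso; lia.
    - constructor 1; lia.
    - constructor 2; lia.
    - constructor 3; lia.
    - constructor 4; constructor 1; lia.
    - constructor 4; constructor 2; lia.
    - constructor 4; constructor 3; lia.
    - constructor 4; constructor 4; lia.
  clear m8 d5 mel.
  move=> [[? ?]|[? ?]|[[? ?]|[? ?]]|[[[? ?]|[? ?]]|[[? ?]|[? ?]]|[? ?]|[? ?]]];
    subst m n4.
  - by apply: (conclude 4 0 5)%N => //; lia.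
  - by apply: (conclude 6 1 7)%N => //; lia.
  - by apply: (conclude 6 4 9)%N => //; lia.
  - by apply: (conclude 9 1 9)%N => //; lia.
  - by apply: (conclude 10 3 11)%N => //; lia.
  - by apply: (conclude 13 0 11)%N => //; lia.
  - by apply: (conclude 12 4 13)%N => //; lia.
  - by apply: (conclude 15 1 13)%N => //; lia.
  - by apply: (conclude 18 1 15)%N => //; lia.
  - by apply: (conclude 22 0 17)%N => //; lia.
have e3 : (n3 + 3 * n4 + 2 * m = m * m + 3)%N by nia.
have e2 : (n2 + m * m + 9 = 3 * n4 + 5 * m)%N by nia.
(* Here the same two bounds combine to [(m - 5)(m - 6) <= 0]. *)
have : (m = 5 /\ n4 = 6 \/ m = 6 /\ n4 = 9)%N by nia.
move=> [[? ?]|[? ?]]; subst m n4.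
- by apply: (conclude 9 0 10)%N => //; lia.
- by apply: (conclude 12 0 12)%N => //; lia.
Qed.

(** * Variance under affine maps *)

Section Variance.
Variables (R : realFieldType) (T : finType) (A : {set T}).
Implicit Types s t : T -> R.

(** The usual variance times the square of [#|A|], which avoids division. *)
Definition variance s := #|A|%:R * (\sum_(q in A) s q ^+ 2) - (\sum_(q in A) s q) ^+ 2.

Lemma sum_const_in (c : R) : \sum_(q in A) c = #|A|%:R * c.
Proof. by rewrite sumr_const mulr_natl. Qed.

Lemma sum_affine s (h b : R) :
  \sum_(q in A) (h - b * s q) = #|A|%:R * h - b * \sum_(q in A) s q.
Proof. by rewrite sumrB sum_const_in -mulr_sumr. Qed.

Lemma sum_sqr_affine s (h b : R) : \sum_(q in A) (h - b * s q) ^+ 2 =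
  #|A|%:R * h ^+ 2 - 2 * h * b * (\sum_(q in A) s q) + b ^+ 2 * \sum_(q in A) s q ^+ 2.
Proof.
rewrite !mulr_sumr -sum_const_in -sumrB -big_split /=.
by apply: eq_bigr => q _; ring.
Qed.

Lemma variance_affine s (h b : R) :
  variance (fun q => h - b * s q) = b ^+ 2 * variance s.
Proof. by rewrite /variance sum_affine sum_sqr_affine; ring. Qed.

Lemma variance_eq0 s : variance s = 0 -> {in A &, forall p q, s p = s q}.
Proof.
move=> V0; set S := \sum_(q in A) s q.
have H : \sum_(q in A) (S - #|A|%:R * s q) ^+ 2 = 0.
  rewrite sum_sqr_affine -/S; transitivity (#|A|%:R * variance s); last by rewrite V0 mulr0.
  by rewrite /variance -/S; ring.
have nz q : q \in A -> #|A|%:R * s q = S.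
  move=> qA; apply/esym/eqP; rewrite -subr_eq0 -sqrf_eq0; apply/eqP.
  by apply: (psumr_eq0P _ H) => // i _; rewrite sqr_ge0.
move=> p q pA qA; have a0 : #|A|%:R != 0 :> R.
  by rewrite pnatr_eq0 -lt0n; apply/card_gt0P; exists p.
by apply: (mulfI a0); rewrite !nz.
Qed.
End Variance.

Lemma variance_imset (R : realFieldType) (T T' : finType) (A : {set T}) (f : T -> T')
    (s : T' -> R) :
  {in A &, injective f} -> variance (f @: A) s = variance A (s \o f).
Proof. by move=> f_inj; rewrite /variance !big_imset ?card_in_imset. Qed.

Section Exclusion.
Variables (R : realFieldType) (I Pt : finType).
Variables (n : I -> 'rV[R]_3) (v : Pt -> 'rV[R]_3).
Hypothesis C : configuration n v.
Local Notation inc := (incident n v).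
Local Notation mult := (mult_in n v).
Local Notation nb := (nb n v).
Local Notation nb_on := (nb_on n v).
Local Notation kpts := (kpts n v).
Implicit Types (i j : I) (p q : Pt).
Hypothesis mult24 : forall p, (2 <= mult setT p <= 4)%N.

Let meet_same := meet_uniq C.

Lemma sum_nb_on34_ge (t : nat) : (forall i, t <= nb_on 3 i + nb_on 4 i)%N ->
  (#|I| * t <= 3 * nb 3 + 4 * nb 4)%N.
Proof.
by move=> h; rewrite -!sum_nb_on -big_split -sum_nat_const; apply: leq_sum.
Qed.

(** With [c] the number of 4-fold points on a line, [(c - t)(c - t - 1) >= 0] bounds [2tc] by
    [c(c - 1) + t(t + 1)]; summing over the lines leaves the pair count. The parameter [t] is chosen
    near the average of [c]. *)
Lemma nb4_pairs (t : nat) :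
  (2 * t * (4 * nb 4) <= nb 4 * (nb 4).-1 + #|I| * (t * t.+1))%N.
Proof.
have P := sum_nb_on_pairs C 4.
apply: leq_trans (leq_add P (leqnn _)); rewrite -sum_nb_on -sum_nat_const -big_split.
rewrite big_distrr; apply: leq_sum => i _ /=; move: (nb_on 4 i) => c.
case: (leqP c t) => [/subnKC <-|/subnKC <-]; move: (_ - _)%N => e.
  by case: c => [|c] /=; nia.
by rewrite /=; nia.
Qed.

(** If all 4-fold points were on one line [u], every line other than [u] would contain at most one
    of them. The incidence count would then give [4 nb 4 <= nb 4 + #|I|]. *)
Lemma nonpencil_kpts4 : (#|I| < 3 * nb 4)%N -> nonpencil v (kpts 4).
Proof.
move=> I3 u u0; apply: contrapT => no.
have ku p : p \in kpts 4 -> dot (v p) u = 0.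
  by move=> pk; apply/eqP/negPn/negP => h; apply: no; exists p.
have le1 i : ~~ (n i <= u)%MS -> (nb_on 4 i <= 1)%N.
  move=> iu; apply/card_le1_eqP => p q; rewrite !inE => /andP[/eqP pi p4] /andP[/eqP qi q4].
  apply/eqP/contraT => /(point_sep C); apply: contraNT => _.
  have up : dot u (v p) = 0 by rewrite dotC ku // inE.
  have uq : dot u (v q) = 0 by rewrite dotC ku // inE.
  have [x ->] := common_kernel_scale iu u0 (point_neq0 C p) pi up qi uq.
  exact: scalemx_sub.
have le4 i : (nb_on 4 i <= nb 4)%N.
  by apply/subset_leq_card/subsetP=> p; rewrite !inE => /andP[].
have := sum_nb_on n v 4; have [i iu|no'] := pickP (fun i => (n i <= u)%MS).
  rewrite (bigD1 i) //= => E.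
  have : (\sum_(j | j != i) nb_on 4 j <= #|I|)%N.
    apply: (@leq_trans (\sum_(j : I) 1)); last by rewrite sum_nat_const muln1.
    rewrite big_mkcond; apply: leq_sum => j _; case: ifP => // ji; apply: le1.
    have /sub_rVP[a Ea] := iu.
    have a0 : a != 0 by apply: contraNneq (line_neq0 C i) => a0; rewrite Ea a0 scale0r.
    apply: contra (line_sep C ji) => ju; apply: submx_trans ju _.
    by rewrite Ea eqmx_scale.
  have := le4 i; lia.
have : (\sum_j nb_on 4 j <= #|I|)%N.
  apply: (@leq_trans (\sum_(j : I) 1)); last by rewrite sum_nat_const muln1.
  by apply: leq_sum => j _; apply: le1; rewrite no'.
lia.
Qed.

Lemma dual_melchior_nb : (#|I| < 3 * nb 4)%N ->
  (6 + 32 * nb 4 <= nb 4 * (nb 4).-1 + 18 * #|I|)%N.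
Proof. by move=> /nonpencil_kpts4 /(dual_melchior C); lia. Qed.

(** For 7 and 10 lines, deletion forces at least 2 and 3 points of multiplicity 3 or 4 on each line,
    hence too many incidences: 14 against 11 and 30 against 24. Pair counting excludes (9; 9, 1, 4)
    and (11; 13, 0, 7), and the dual inequality the last three. *)
Lemma exclude_by_counting : (#|I|, nb 2, nb 3, nb 4) \notin
  [:: (7, 6, 1, 2); (9, 9, 1, 4); (10, 9, 0, 6); (11, 13, 0, 7);
      (12, 12, 0, 9); (13, 15, 1, 10); (15, 18, 1, 14)]%N.
Proof.
apply/negP; rewrite !inE !xpair_eqE -!andbA => /orP[|/orP[|/orP[|/orP[|/orP[|/orP[]]]]]].
- case/and4P=> /eqP d /eqP n2 /eqP n3 /eqP n4.
  have := @sum_nb_on34_ge 2; rewrite d n3 n4 => /(_ _)/notF; apply=> i.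
  by have := line_count C mult24 i; have := line_deletion C mult24 i; rewrite d n2 n4; lia.
- case/and4P=> /eqP d /eqP n2 /eqP n3 /eqP n4.
  by have := nb4_pairs 1; rewrite d n4.
- case/and4P=> /eqP d /eqP n2 /eqP n3 /eqP n4.
  have := @sum_nb_on34_ge 3; rewrite d n3 n4 => /(_ _)/notF; apply=> i.
  by have := line_count C mult24 i; have := line_deletion C mult24 i; rewrite d n2 n4; lia.
- case/and4P=> /eqP d /eqP n2 /eqP n3 /eqP n4.
  by have := nb4_pairs 2; rewrite d n4.
- case/and4P=> /eqP d /eqP n2 /eqP n3 /eqP n4.
  by have := dual_melchior_nb; rewrite d n4 => /(_ isT).
- case/and4P=> /eqP d /eqP n2 /eqP n3 /eqP n4.
  by have := dual_melchior_nb; rewrite d n4 => /(_ isT).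
- case/and4P=> /eqP d /eqP n2 /eqP n3 /eqP n4.
  by have := dual_melchior_nb; rewrite d n4 => /(_ isT).
Qed.

(* Call a line special if it has four 4-fold points. Deleting three special lines
   through a 4-fold point would violate Melchior's inequality, so a 4-fold point
   is on at most two of them; counting along a special line, each of its points
   is on exactly two. A line that is not special thus meets an even number of
   special lines, but there are nine. *)
Lemma exclude_17 : (#|I|, nb 2, nb 3, nb 4) <> (17, 22, 0, 19)%N.
Proof.
move=> [d n2 n3 n4].
have b0 i : nb_on 3 i = 0%N.
  have /eqP := sum_nb_on n v 3; rewrite n3 muln0 sum_nat_eq0 => /forallP/(_ i).
  by move/implyP/(_ isT)/eqP.
(* The line count is [nb_on 2 i + 3 nb_on 4 i = 16], and deletion gives [nb_on 2 i <= nb_on 4 i]. *)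
have ac i : (nb_on 2 i = 4 /\ nb_on 4 i = 4 \/ nb_on 2 i = 1 /\ nb_on 4 i = 5)%N.
  have := line_count C mult24 i; have := line_deletion C mult24 i.
  by rewrite d n2 n4 b0; move: (nb_on 2 i) (nb_on 4 i); lia.
pose F := [set i | nb_on 4 i == 4%N].
have F9 : #|F| = 9%N.
  have : (\sum_i (nb_on 4 i + (i \in F)) = #|I| * 5)%N.
    rewrite -sum_nat_const; apply: eq_bigr => i _; rewrite inE.
    by case: (ac i) => -[_ ->].
  rewrite big_split /= sum_nb_on n4 d -card_sum_bool => E.
  have -> : #|F| = #|[set i | i \in F]| by apply: eq_card => i; rewrite inE.
  lia.
have F2 p : (mult F p <= 2)%N.
  have [p4|p4] := eqVneq (mult setT p) 4%N; last first.
    apply: (@leq_trans (mult setT p)).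
      by apply/subset_leq_card/subsetP=> i; rewrite !inE => /andP[_ ->].
    have p3 : mult setT p != 3%N.
      apply/eqP=> p3; have : (0 < nb 3)%N by apply/card_gt0P; exists p; rewrite inE p3.
      by rewrite n3.
    by move: (mult24 p) p3 p4; case: (mult setT p) => [|[|[|[|[|k]]]]].
  rewrite leqNgt; apply/negP => /card_gt2P[x [y [z [[xF yF zF] [xy yz zx]]]]].
  move: xF yF zF; rewrite !inE => /andP[/eqP xF xp] /andP[/eqP yF yp] /andP[/eqP zF zp].
  pose T := [set x; y; z].
  have T3 : #|T| = 3%N.
    by rewrite /T -setUA !cardsU1 cards1 !inE negb_or xy (eq_sym x) zx yz.
  have TF i : i \in T -> nb_on 4 i = 4%N /\ inc i p.
    by rewrite !inE -orbA => /or3P[] /eqP->.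
  have npT : nonpencil n (~: T).
    by apply: (nonpencil_ge5 C mult24); rewrite cardsCs setCK T3 d.
  (* The full sum is 22 - 19 = 3. The three special lines contribute 0 each and the correction at
     [p] is -2, leaving 1 where 3 is required. *)
  have := melchior C npT; rewrite (excess_deletion C mult24 (p := p)) => [|i /TF[]//].
  rewrite big1 => [|i /TF[i4 _]]; last first.
    by rewrite b0 i4; case: (ac i) => -[]; rewrite i4 => // ->.
  by rewrite T3 p4 n2 n4.
have FF i q : i \in F -> inc i q -> mult F q = 2%N.
  move=> iF; have iF' : i \notin F :\ i by rewrite !inE eqxx.
  have multF q' : inc i q' -> mult F q' = (mult (F :\ i) q').+1.
    by move=> iq'; have := multU1 n v q' iF'; rewrite setD1K // iq'.
  have SF := sum_mult_line C iF'.
  have F8 : #|F :\ i| = 8%N by move: F9; rewrite (cardsD1 i) iF => -[].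
  (* Eight points on the special line must receive the eight other special lines, at most one each,
     so every point receives exactly one. *)
  have N : (\sum_(q | inc i q) 1 = 8)%N.
    apply: (can_inj absz_nat); rewrite sum_int (sum_by_mult mult24 _ (fun=> 1)).
    have i4 : nb_on 4 i = 4%N by move: iF; rewrite inE => /eqP.
    by rewrite -!/(nb_on _ i) b0 i4; case: (ac i) => -[]; rewrite i4 => // ->.
  move=> iq; rewrite multF //; congr _.+1; apply/eqP; rewrite eqn_leq.
  have le1 q' : inc i q' -> (mult (F :\ i) q' <= 1)%N.
    by move=> iq'; have := F2 q'; rewrite multF.
  rewrite le1 //=; rewrite lt0n; apply/negP => /eqP q0.
  move: SF N; rewrite (bigD1 q) //= q0 add0n F8 => SF; rewrite (bigD1 q) //= => N.
  have : (\sum_(q' | inc i q' && (q' != q)) mult (F :\ i) q' <=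
          \sum_(q' | inc i q' && (q' != q)) 1)%N.
    by apply: leq_sum => q' /andP[iq' _]; exact: le1.
  by rewrite SF; lia.
have [i iF] : exists i, i \notin F.
  apply/existsP; apply: contraT; rewrite negb_exists => /forallP h.
  have : #|F| = #|I| by apply: eq_card => i; have := h i; rewrite negbK => ->.
  by rewrite F9 d.
have := sum_mult_line C iF; rewrite F9 => S.
have : (2 %| \sum_(p | inc i p) mult F p)%N.
  apply: dvdn_sum => p _; case: (posnP (mult F p)) => [-> //|/mult_gt0[j jF jp]].
  by rewrite (FF j p).
by rewrite S.
Qed.

(** Each further k-fold point is joined to [p] by at most one line. *)
Lemma sum_nb_on_through p k : mult setT p = k ->
  (\sum_(i | inc i p) (nb_on k i).-1 <= (nb k).-1)%N.
Proof.
move=> pk; have -> : (nb k).-1 = #|kpts k :\ p| by rewrite /nb (cardsD1 p) inE pk eqxx.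
rewrite -sum1_card.
have E i : inc i p -> (nb_on k i).-1 = (\sum_(q in kpts k :\ p) inc i q)%N.
  move=> ip; rewrite /nb_on (cardsD1 p) !inE ip pk eqxx /= -sum1_card big_mkcond [RHS]big_mkcond.
  apply: eq_bigr => q _; rewrite !inE.
  by case: (q == p) => //=; case: (inc i q); case: (_ == k).
rewrite (eq_bigr _ E) exchange_big; apply: leq_sum => q; rewrite !inE => /andP[qp _] /=.
have [i /andP[ip iq]|no] := pickP (fun i => inc i p && inc i q); last first.
  by rewrite big1 // => i ip; have := no i; rewrite ip /= => ->.
rewrite (bigD1 i) //= big1 ?addn0 ?leq_b1 // => j /andP[jp ji].
apply/eqP; rewrite eqb0; apply: contra qp => jq.
by rewrite (meet_same ji jp ip jq iq).
Qed.

(* Since [sum_nb_on_pairs] is sharp here, there are two lines [A], [B] with three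
   4-fold points each, and any other line joins a 4-fold point of [A] to one of [B].
   Projecting from a triple point maps the 4-fold points of [A] onto those of [B]; in
   coordinates sending the common point [O] of [A] and [B] to infinity this map is
   affine, and an affine bijection between two finite subsets of the real line is
   determined up to orientation by their means and variances. So there would be at
   most two triple points. *)
Lemma exclude_11 : (#|I|, nb 2, nb 3, nb 4) <> (11, 10, 3, 6)%N.
Proof.
move=> [d n2 n3 n4].
have lc i := line_count C mult24 i.
have c23 i : ((nb_on 4 i == 2) || (nb_on 4 i == 3))%N.
  pose bad j := ~~ ((nb_on 4 j == 2) || (nb_on 4 j == 3))%N.
  have h j : (4 * nb_on 4 j + bad j <= nb_on 4 j * (nb_on 4 j).-1 + 6)%N.
    have := lc j; rewrite d /bad; case: (nb_on 4 j) => [|[|[|[|c]]]] //=; lia.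
  (* The bound 96 = 6 * 5 + 11 * 6 is already attained by 4 * 24 without the [bad] terms, so there
     are no bad lines. *)
  have : (\sum_j (4 * nb_on 4 j + bad j) <= 96)%N.
    apply: (@leq_trans (\sum_j (nb_on 4 j * (nb_on 4 j).-1 + 6))%N).
      by apply: leq_sum => j _; exact: h.
    rewrite big_split /= sum_nat_const d.
    by have := sum_nb_on_pairs C 4; rewrite n4 => P; rewrite (leq_add P).
  rewrite big_split /= -big_distrr /= sum_nb_on n4 => B0.
  have : (\sum_j bad j == 0)%N by rewrite -leqn0; lia.
  by rewrite sum_nat_eq0 => /forallP/(_ i)/implyP/(_ isT); rewrite eqb0 negbK.
pose H := [set i | nb_on 4 i == 3%N].
have cH i : nb_on 4 i = (2 + (i \in H))%N.
  by rewrite inE; case/orP: (c23 i) => /eqP ->.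
have [A [B [AB HE]]] : exists A B, A != B /\ H = [set A; B].
  apply/cards2P/eqP.
  (* As 24 = 2 * 11 + 2, exactly two lines have a third 4-fold point. *)
  have : (\sum_i nb_on 4 i = 24)%N by rewrite sum_nb_on n4.
  under eq_bigr do rewrite cH; rewrite big_split /= sum_nat_const d -card_sum_bool.
  have -> : #|[set i | i \in H]| = #|H| by apply: eq_card => i; rewrite inE.
  lia.
have AH : A \in H by rewrite HE !inE eqxx.
have BH : B \in H by rewrite HE !inE eqxx orbT.
(* A common 4-fold point of [A] and [B] would be joined to at least 4 + 2 others, but only five
   exist. *)
have noAB p : mult setT p = 4%N -> inc A p -> inc B p -> False.
  move=> p4 Ap Bp; have := sum_nb_on_through p4; rewrite n4.
  have -> : (\sum_(i | inc i p) (nb_on 4 i).-1 = mult setT p + mult H p)%N.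
    rewrite /mult_in !card_sum_bool -big_split big_mkcond; apply: eq_bigr => i _.
    by rewrite in_setT cH /=; case: (inc i p); case: (i \in H).
  have : (2 <= mult H p)%N; last by rewrite p4; lia.
  by apply/card_gt1P; exists A, B; rewrite ![_ \in [set i in H | _]]inE AH BH.

pose QA := [set p | inc A p & mult setT p == 4%N].
pose QB := [set p | inc B p & mult setT p == 4%N].
have QA3 : #|QA| = 3%N by rewrite -/(nb_on 4 A) cH AH.
have QB3 : #|QB| = 3%N by rewrite -/(nb_on 4 B) cH BH.
have QAB p : mult setT p = 4%N -> (p \in QA) || (p \in QB).
  move=> p4; have : p \in kpts 4 by rewrite inE p4.
  have -> : kpts 4 = QA :|: QB; last by rewrite in_setU.
  apply/esym/eqP; rewrite eqEcard; apply/andP; split.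
    by apply/subsetP=> q; rewrite !inE => /orP[] /andP[].
  rewrite cardsU (_ : QA :&: QB = set0) ?cards0 ?QA3 ?QB3; first by rewrite -/(nb 4) n4.
  apply/setP=> q; rewrite !inE; apply/negP => /andP[/andP[Aq /eqP q4] /andP[Bq _]].
  exact: noAB q4 Aq Bq.
have [O AO BO] := line_meet C AB.
have O4 : mult setT O != 4%N by apply/eqP => O4; exact: noAB O4 AO BO.
(* Three 4-fold points account for nine of the ten other lines, which leaves no room for a triple
   point. *)
have notAB T i : mult setT T = 3%N -> inc i T -> i \notin H.
  move=> T3 iT; apply/negP => iH; have : (0 < nb_on 3 i)%N.
    by apply/card_gt0P; exists T; rewrite inE iT T3.
  by have := lc i; rewrite d cH iH; lia.
have joins i : i \notin H -> exists a b, [/\ a \in QA, b \in QB, inc i a & inc i b].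
  move=> iH; have : (1 < nb_on 4 i)%N by rewrite cH (negbTE iH).
  have notA : i != A by apply: contraNneq iH => ->.
  have notB : i != B by apply: contraNneq iH => ->.
  move=> /card_gt1P[p [q []]]; rewrite !inE => /andP[ip p4] /andP[iq q4] pq.
  case/orP: (QAB p (eqP p4)) (QAB q (eqP q4)) => [pA|pB] /orP[qA|qB].
  - case/eqP: pq; move: pA qA; rewrite !inE => /andP[pA _] /andP[qA _].
    exact: meet_same notA ip pA iq qA.
  - by exists p, q.
  - by exists q, p.
  - case/eqP: pq; move: pB qB; rewrite !inE => /andP[pB _] /andP[qB _].
    exact: meet_same notB ip pB iq qB.
(* The form [h] completes [A] and [B] to a coordinate system in which [O] has first two coordinates
   zero. *)
have [h hO] := exists_dot_neq0 (point_neq0 C O); rewrite dotC in hO.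
pose xA p := dot (n A) (v p); pose xB p := dot (n B) (v p); pose xh p := dot h (v p).
have zero w : dot (n A) w = 0 -> dot (n B) w = 0 -> dot h w = 0 -> w = 0.
  move=> wA wB wh.
  have [c E] := common_kernel_scale (line_sep C AB) (line_neq0 C B)
    (point_neq0 C O) (eqP AO) (eqP BO) wA wB.
  move: wh; rewrite E dotZr => /eqP; rewrite mulf_eq0 (negbTE hO) orbF => /eqP ->.
  by rewrite scale0r.
have xA0 p : p \in QA -> xA p = 0 by rewrite inE => /andP[/eqP].
have xB0 p : p \in QB -> xB p = 0 by rewrite inE => /andP[/eqP].
have xBn p : p \in QA -> xB p != 0.
  rewrite inE => /andP[Ap /eqP p4]; apply/negP => Bp; exact: noAB p4 Ap Bp.
have xAn p : p \in QB -> xA p != 0.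
  rewrite inE => /andP[Bp /eqP p4]; apply/negP => Ap; exact: noAB p4 Ap Bp.
(* Affine coordinates on [A] and on [B] with [O] at infinity. *)
pose s p := xh p / xB p; pose t p := xh p / xA p.
have collinear i T a b : i \notin H -> inc i T -> inc i a -> inc i b ->
    a \in QA -> b \in QB -> xh T = xA T * t b + xB T * s a.
  move=> iH iT ia ib aQ bQ.
  have iA : i != A by apply: contraNneq iH => ->.
  have iO : dot (n i) (v O) != 0.
    apply/negP => iO; move: (aQ); rewrite inE => /andP[Aa a4].
    by move: O4; rewrite -(meet_same iA ia Aa iO AO) a4.
  (* This combination vanishes on [A] and [B] by construction, so it is a multiple of [v O]. It also
     vanishes on [i], which misses [O], hence it is zero, and [h] reads off the relation. *)
  set w := v T - (xA T / xA b) *: v b - (xB T / xB a) *: v a.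
  have wA : dot (n A) w = 0.
    rewrite !dotBr !dotZr -/(xA T) -/(xA b) -/(xA a) divfK ?xAn // (xA0 a) //.
    by rewrite subrr mulr0 subrr.
  have wB : dot (n B) w = 0.
    rewrite !dotBr !dotZr -/(xB T) -/(xB b) -/(xB a) divfK ?xBn // (xB0 b) //.
    by rewrite mulr0 subr0 subrr.
  have wi : dot (n i) w = 0.
    by rewrite !dotBr !dotZr (eqP iT) (eqP ia) (eqP ib) !mulr0 !subr0.
  have [c E] := common_kernel_scale (line_sep C AB) (line_neq0 C B)
    (point_neq0 C O) (eqP AO) (eqP BO) wA wB.
  have c0 : c = 0.
    by move: wi; rewrite E dotZr => /eqP; rewrite mulf_eq0 (negbTE iO) orbF => /eqP.
  have : dot h w = 0 by rewrite E c0 scale0r -(scale0r (0 : 'rV[R]_3)) dotZr mul0r.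
  rewrite !dotBr !dotZr -/(xh T) -/(xh b) -/(xh a) => /eqP.
  rewrite -addrA -opprD subr_eq0 => /eqP ->; rewrite /t /s.
  by congr (_ + _); rewrite mulrAC mulrA.
have proj T : mult setT T = 3%N ->
    [/\ xA T != 0, xB T != 0, xB T ^+ 2 * variance QA s = xA T ^+ 2 * variance QB t
      & 3 * xh T = xA T * (\sum_(b in QB) t b) + xB T * (\sum_(a in QA) s a)].
  move=> T3; pose LT := [set i | inc i T].
  have LT3 : #|LT| = 3%N by rewrite -T3; apply: eq_card => i; rewrite !inE.
  have notH i : i \in LT -> i \notin H by rewrite inE; exact: notAB.
  pose a i := odflt O [pick p in QA | inc i p].
  pose b i := odflt O [pick p in QB | inc i p].
  have aP i : i \in LT -> a i \in QA /\ inc i (a i).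
    move=> /notH/joins[p [q [pQ _ ip _]]]; rewrite /a; case: pickP => [x /andP[]//|/(_ p)].
    by rewrite pQ ip.
  have bP i : i \in LT -> b i \in QB /\ inc i (b i).
    move=> /notH/joins[p [q [_ qQ _ iq]]]; rewrite /b; case: pickP => [x /andP[]//|/(_ q)].
    by rewrite qQ iq.
  have inj (Q : {set Pt}) f : (forall i, i \in LT -> f i \in Q /\ inc i (f i)) ->
      {in Q, forall q, mult setT q == 4%N} -> #|Q| = 3%N ->
      {in LT &, injective f} /\ f @: LT = Q.
    move=> fP Q4 Q3; have f_inj : {in LT &, injective f}.
      move=> i j iL jL E; apply/eqP/contraT => ij.
      have [fQ ifi] := fP i iL; have [_ jfj] := fP j jL; rewrite -E in jfj.
      move: iL jL; rewrite !inE => iT jT.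
      by have := Q4 _ fQ; rewrite -(meet_same ij iT jT ifi jfj) T3.
    split=> //; apply/eqP; rewrite eqEcard card_in_imset // LT3 Q3 leqnn andbT.
    by apply/subsetP=> _ /imsetP[i iL ->]; case: (fP i iL).
  have [a_inj aE] : {in LT &, injective a} /\ a @: LT = QA.
    by apply: inj => // q; rewrite inE => /andP[].
  have [b_inj bE] : {in LT &, injective b} /\ b @: LT = QB.
    by apply: inj => // q; rewrite inE => /andP[].
  have eqi i : i \in LT -> xA T * t (b i) = xh T - xB T * s (a i).
    move=> iL; have [aQ ia] := aP i iL; have [bQ ib] := bP i iL.
    rewrite (@collinear i T (a i) (b i)) ?addrK //; first exact: notH.
    by move: iL; rewrite inE.
  have sums : xA T * (\sum_(b in QB) t b) = 3 * xh T - xB T * (\sum_(a in QA) s a).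
    rewrite -aE -bE !big_imset //= mulr_sumr (eq_bigr _ eqi) sum_affine LT3 //.
  split.
  - by apply/negP => AT; have := notAB T A T3 AT; rewrite AH.
  - by apply/negP => BT; have := notAB T B T3 BT; rewrite BH.
  - rewrite -aE -bE !variance_imset // -(variance_affine _ _ (xh T)) /variance.
    rewrite -(eq_bigr _ eqi) -mulr_sumr.
    have -> : \sum_(i in LT) (xh T - xB T * (s \o a) i) ^+ 2 =
        xA T ^+ 2 * \sum_(i in LT) t (b i) ^+ 2.
      by rewrite mulr_sumr; apply: eq_bigr => i iL; rewrite /= -eqi // exprMn.
    by rewrite /=; ring.
  - by rewrite sums subrK.
have Vs : variance QA s != 0.
  apply/eqP => /variance_eq0 V.
  have /card_gt1P[p [q [pQ qQ pq]]] : (1 < #|QA|)%N by rewrite QA3.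
  have w0 : xB q *: v p - xB p *: v q = 0.
    apply: zero; rewrite dotBr !dotZr; first by rewrite -!/(xA _) !xA0 // !mulr0 subrr.
      by rewrite -!/(xB _) mulrC subrr.
    have := V p q pQ qQ; rewrite /s -!/(xh _) => /eqP.
    by rewrite eqr_div ?xBn // => /eqP E; rewrite mulrC E mulrC subrr.
  have := point_sep C pq; rewrite -(eqmx_scale _ (xBn q qQ)).
  by move/eqP: w0; rewrite subr_eq0 => /eqP ->; rewrite scalemx_sub.
(* Comparing variances shows that the ratio of [xA] to [xB] is the same up to sign at all triple
   points. With equal signs the means would give proportional third coordinates and the two points
   would coincide. *)
have opposite T T' : T != T' -> mult setT T = 3%N -> mult setT T' = 3%N ->
    xB T * xA T' = - (xB T' * xA T).
  move=> TT' /proj[AT BT V M] /proj[AT' BT' V' M'].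
  have : (xB T * xA T' - xB T' * xA T) * (xB T * xA T' + xB T' * xA T) * variance QA s = 0.
    transitivity (xA T' ^+ 2 * (xB T ^+ 2 * variance QA s)
                  - xA T ^+ 2 * (xB T' ^+ 2 * variance QA s)).
      ring.
    by rewrite V V'; ring.
  move/eqP; rewrite !mulf_eq0 (negbTE Vs) orbF => /orP[|]; last by rewrite addr_eq0 => /eqP.
  rewrite subr_eq0 => /eqP E; exfalso.
  have w0 : xA T' *: v T - xA T *: v T' = 0.
    apply: zero; rewrite dotBr !dotZr; first by rewrite -!/(xA _) mulrC subrr.
      by rewrite -!/(xB _) mulrC E mulrC subrr.
    have three : (3 : R) != 0 by rewrite pnatr_eq0.
    apply: (mulfI three); rewrite mulr0 mulrBr !(mulrCA 3) -!/(xh _) M M'.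
    by ring: E.
  have := point_sep C TT'; rewrite -(eqmx_scale _ AT').
  by move/eqP: w0; rewrite subr_eq0 => /eqP ->; rewrite scalemx_sub.
have /card_gt2P[T1 [T2 [T3 [[]]]]] : (2 < #|kpts 3|)%N by rewrite -/(nb 3) n3.
rewrite !inE => /eqP t1 /eqP t2 /eqP t3 [d12 d23 d31].
have [[a1 b1 _ _] [a2 b2 _ _]] := (proj _ t1, proj _ t2); have [a3 b3 _ _] := proj _ t3.
have E12 := opposite _ _ d12 t1 t2; have E23 := opposite _ _ d23 t2 t3.
have E31 := opposite _ _ d31 t3 t1.
(* Three nonzero ratios cannot be pairwise opposite: this product would equal its own negative. *)
have /eqP : (xB T1 * xA T2) * (xB T2 * xA T3) * (xB T3 * xA T1) != 0 by rewrite !mulf_neq0.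
have : (xB T1 * xA T2) * (xB T2 * xA T3) * (xB T3 * xA T1) =
  - ((xB T1 * xA T2) * (xB T2 * xA T3) * (xB T3 * xA T1)).
  by rewrite {1}E12 {1}E23 {1}E31; ring.
by move: (_ * _ * _) => x xN; apply; lra.
Qed.

Lemma M_configuration_classification m : nonpencil n setT ->
  [/\ #|I| = 2 * m + 1, 5 <= #|I| & nb 2 + 4 * nb 3 + 9 * nb 4 = 3 * m ^ 2 + 1]%N \/
  [/\ #|I| = 2 * m, 4 <= #|I| & nb 2 + 4 * nb 3 + 9 * nb 4 = 3 * m ^ 2 - 3 * m + 3]%N ->
  (#|I|, nb 2, nb 3, nb 4) \in [:: (5, 4, 0, 1); (9, 6, 4, 3); (13, 12, 4, 9)]%N.
Proof.
move=> np M.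
have pairs : (2 * nb 2 + 6 * nb 3 + 12 * nb 4 = #|I| * #|I|.-1)%N.
  have : (\sum_i (nb_on 2 i + 2 * nb_on 3 i + 3 * nb_on 4 i) = #|I| * #|I|.-1)%N.
    by rewrite (eq_bigr _ (fun i _ => line_count C mult24 i)) sum_nat_const.
  have D c k : (\sum_i c * nb_on k i = c * (k * nb k))%N.
    by rewrite -sum_nb_on big_distrr.
  by rewrite 2!big_split /= !D sum_nb_on; lia.
have mel : (nb 4 + 3 <= nb 2)%N.
  by have := melchior C np; rewrite (sum_excess_mult mult24); lia.
have := weak_combinatorics_cases pairs mel M.
have := exclude_by_counting; have := exclude_17; have := exclude_11.
move: (#|I|, nb 2, nb 3, nb 4) => x /eqP x11 /eqP x17; rewrite !inE !negb_or.
rewrite (negbTE x11) (negbTE x17) => /and5P[/negbTE-> /negbTE-> /negbTE-> /negbTE->].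
by case/and3P=> /negbTE-> /negbTE-> /negbTE->; rewrite !orbF.
Qed.
End Exclusion.

(** * Arrangements in the projective plane *)

From mathcomp Require Import finmap generic_quotient complex.
From mathcomp Require Import all_classical all_reals topology normedtype.

Import numFieldNormedType.Exports.

Section Projective.
Local Open Scope quotient_scope.
Variable F : fieldType.
Implicit Types (P Q l : pplane F).

Lemma on_line_dot P l : on_line P l = (dot (coords l) (coords P) == 0).
Proof. by rewrite /on_line -dot_eq0 dotC. Qed.

Lemma coords_sep P Q : P != Q -> ~~ (coords P <= coords Q)%MS.
Proof.
apply: contra => PQ; apply/eqP/coords_inj.
by rewrite -(geq_leqif (mxrank_leqif_eq PQ)) !rank_rV !coords_neq0.
Qed.

Lemma exists_common_point (l1 l2 : pplane F) : exists2 P, on_line P l1 & on_line P l2.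
Proof.
have [x x0 [h1 h2]] := exists_common_kernel (coords l1) (coords l2).
have [a E] : exists a, coords (\pi_(pplane F) (exist _ x x0)) = a *: x.
  by apply/sub_rVP; rewrite coords_pi.
by exists (\pi_(pplane F) (exist _ x x0)); rewrite on_line_dot E dotZr ?h1 ?h2 mulr0.
Qed.

Lemma coords_pi_scale (u : nzvec F) :
  exists2 a, a != 0 & coords (\pi_(pplane F) u) = a *: sval u.
Proof.
have [a E] : exists a, coords (\pi_(pplane F) u) = a *: sval u.
  by apply/sub_rVP; rewrite coords_pi.
exists a => //; apply: contraNneq (coords_neq0 (\pi_(pplane F) u)) => a0.
by rewrite E a0 scale0r.
Qed.

End Projective.

Section FsetCard.
Local Open Scope fset_scope.
Variables (T : choiceType) (A : {fset T}) (P : pred T).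

Lemma card_set_fset : #|[set x : A | P (val x)]| = #|` [fset x in A | P x] |.
Proof.
have -> : [fset x in A | P x] = [fset val x | x in [set x : A | P (val x)]%SET].
  apply/fsetP=> x; apply/idP/imfsetP => [|[y]].
    rewrite !inE => /andP[xA Px]; exists [` xA] => //=; by rewrite inE.
  by rewrite /= inE => Py ->; rewrite !inE Py fsvalP.
by rewrite card_imfset //=; [rewrite -cardE | exact: val_inj].
Qed.
End FsetCard.

(** * The configuration of a real arrangement *)

Section Instance.
Local Open Scope fset_scope.
Local Open Scope quotient_scope.
Variables (R : realType) (L : arrangement R).
Hypothesis mult4 : forall P, (2 <= multiplicity L P)%N -> (multiplicity L P <= 4)%N.

Definition line_vec (l : L) : 'rV[R]_3 := coords (val l : pplane R).

Definition multiple_points : {fset pplane R} :=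
  fset_set (kfold_points L 2 `|` kfold_points L 3 `|` kfold_points L 4)%classic.

Definition point_vec (P : multiple_points) : 'rV[R]_3 := coords (val P).

Lemma multiple_pointsP P : (P \in multiple_points) = (2 <= multiplicity L P)%N.
Proof.
rewrite in_fset_set; last first.
  by rewrite !finite_setU; split; [split|]; apply: kfold_points_finite.
apply/idP/idP => [|h].
  by rewrite inE => -[[|]|] /= ->.
rewrite inE /=; have := mult4 h; move: h; rewrite /kfold_points /=.
by case: (multiplicity L P) => [|[|[|[|[|k]]]]] //= _ _; [left; left|left; right|right].
Qed.

Lemma inc_on_line l P : incident line_vec point_vec l P = on_line (val P) (val l).
Proof. by rewrite on_line_dot. Qed.

Lemma card_lines_through P :
  #|[set l : L | on_line P (val l)]| = multiplicity L P.
Proof. exact: card_set_fset. Qed.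

Lemma mult_in_setT P : mult_in line_vec point_vec [set: L]%SET P = multiplicity L (val P).
Proof.
by rewrite -card_lines_through; apply: eq_card => l; rewrite !inE inc_on_line.
Qed.

Lemma configuration_arrangement : configuration line_vec point_vec.
Proof.
split=> [l|P|l m lm|P Q PQ|l m lm]; rewrite ?coords_neq0 //.
- by apply: coords_sep; rewrite (inj_eq val_inj).
- by apply: coords_sep; rewrite (inj_eq val_inj).
have [P Pl Pm] := exists_common_point (val l) (val m).
have PX : P \in multiple_points.
  rewrite multiple_pointsP -card_lines_through; apply/card_gt1P.
  by exists l, m; rewrite !inE Pl Pm.
by exists [` PX]; rewrite inc_on_line.
Qed.

Lemma nb_nfold k : (2 <= k <= 4)%N -> nb line_vec point_vec k = nfold L k.
Proof.
move=> k24; rewrite /nb /nfold.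
have -> : fset_set (kfold_points L k) = [fset P in multiple_points | multiplicity L P == k].
  apply/fsetP=> P; rewrite in_fset_set; last by apply: kfold_points_finite; case/andP: k24.
  rewrite !inE multiple_pointsP; apply/idP/andP => [|[_ /eqP]]; rewrite inE //.
  by rewrite /kfold_points /= => ->; rewrite eqxx; case/andP: k24.
by rewrite -card_set_fset; apply: eq_card => P; rewrite !inE mult_in_setT.
Qed.

Lemma mult_in_24 P : (2 <= mult_in line_vec point_vec [set: L]%SET P <= 4)%N.
Proof.
rewrite mult_in_setT; have := fsvalP P; rewrite multiple_pointsP => h.
by rewrite h mult4.
Qed.

Lemma nonpencil_arrangement : ~ pencil L -> nonpencil line_vec [set: L]%SET.
Proof.
move=> np u u0; apply: contrapT => no; apply: np.
have [a a0 E] := coords_pi_scale (exist _ u u0).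
exists (\pi_(pplane R) (exist _ u u0)) => l lL; rewrite on_line_dot E dotZr.
rewrite mulf_eq0 (negbTE a0) /=; apply/negPn/negP => h; apply: no.
by exists [` lL].
Qed.
End Instance.

(** * Multiple points of the complexification *)

Section Complexification.
Local Open Scope fset_scope.
Local Open Scope quotient_scope.
Variable R : realType.
Implicit Types (P l : pplane R) (L : arrangement R).

Lemma coords_complexify P :
  (coords (complexify_line P) :=: map_mx (real_complex R) (coords P))%MS.
Proof. exact: coords_pi. Qed.

Lemma complexify_line_inj : injective (@complexify_line R).
Proof.
move=> P Q E; apply: coords_inj.
have : (coords (complexify_line P) == coords (complexify_line Q))%MS by rewrite E; apply/eqmxP.
by rewrite !coords_complexify !map_submx.
Qed.

Lemma on_line_complexify P l :
  on_line (complexify_line P) (complexify_line l) = on_line P l.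
Proof. by rewrite on_line_pi /= map_trmx -map_mxM map_mx_eq0. Qed.

Lemma multiplicity_complexify L P :
  multiplicity (complexify L) (complexify_line P) = multiplicity L P.
Proof.
rewrite /multiplicity.
have -> : [fset m in complexify L | on_line (complexify_line P) m] =
    [fset complexify_line l | l in [fset l in L | on_line P l]]; last first.
  by rewrite card_imfset //=; exact: complexify_line_inj.
apply/fsetP=> m; rewrite !inE; apply/andP/imfsetP => /= [[/imfsetP[l lL ->]]|[l]].
  by rewrite on_line_complexify => Pl; exists l; rewrite ?inE ?lL.
rewrite !inE => /andP[lL Pl] ->; rewrite on_line_complexify; split=> //.
exact: in_imfset.
Qed.

(** Two distinct real lines already meet in a real point, and over the complex numbers they still
    meet only once. *)
Lemma real_multiple_point L (Q : pplane R[i]) :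
  (2 <= multiplicity (complexify L) Q)%N -> exists P, Q = complexify_line P.
Proof.
rewrite /multiplicity => h.
have /fset0Pn[m1 m1B] : [fset l in complexify L | on_line Q l] != fset0.
  by rewrite -cardfs_gt0 ltnW.
have /fset0Pn[m2] : [fset l in complexify L | on_line Q l] `\ m1 != fset0.
  by rewrite -cardfs_gt0; move: h; rewrite (cardfsD1 m1) m1B.
move: m1B; rewrite !inE /= => /andP[/imfsetP[l1 /= _ ->] Q1].
move=> /andP[m12 /andP[/imfsetP[l2 /= _ E2] Q2]]; rewrite {}E2 in m12 Q2.
have [P P1 P2] := exists_common_point l1 l2; exists P.
have P1' : on_line (complexify_line P) (complexify_line l1) by rewrite on_line_complexify.
have P2' : on_line (complexify_line P) (complexify_line l2) by rewrite on_line_complexify.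
have ne : (complexify_line l1 : pline R[i]) != complexify_line l2.
  by apply/eqP=> E; rewrite E eqxx in m12.
exact (@two_lines_meet_once _ _ _ (complexify_line l1) (complexify_line l2) ne Q1 Q2 P1' P2').
Qed.

Lemma nfold_complexify L k : (2 <= k)%N -> nfold (complexify L) k = nfold L k.
Proof.
move=> k2; rewrite /nfold.
have -> : (kfold_points (complexify L) k = @complexify_line R @` kfold_points L k)%classic.
  apply/seteqP; split=> [Q|_ [P Pk <-]]; last first.
    by rewrite /kfold_points /= multiplicity_complexify.
  rewrite /kfold_points /= => Qk.
  have [P E] : exists P, Q = complexify_line P.
    by apply: (@real_multiple_point L); rewrite Qk.
  by exists P => //=; rewrite -Qk E multiplicity_complexify.
rewrite fset_set_image; last exact: kfold_points_finite.
by rewrite card_imfset //=; exact: complexify_line_inj.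
Qed.

Lemma card_complexify L : #|` complexify L| = #|` L|.
Proof. by rewrite card_imfset //=; exact: complexify_line_inj. Qed.

End Complexification.

(** * Regions of the complement *)

Section Topology.
Local Open Scope classical_set_scope.
Local Open Scope quotient_scope.
Variable R : realType.
Implicit Types (P Q : pplane R) (l m : pplane R).

Lemma dot_continuous (w : 'rV[R]_3) : continuous (fun u : 'rV[R]_3 => dot w u).
Proof.
have -> : (fun u : 'rV[R]_3 => dot w u) =
   (fun u => w 0 0 * u 0 0 + (w 0 (lift 0 0) * u 0 (lift 0 0)
     + (w 0 (lift 0 (lift 0 0)) * u 0 (lift 0 (lift 0 0)) + 0))).
  by apply/funext=> u; rewrite /dot mxE !big_ord_recl big_ord0 !mxE.
move=> u.
have c j : (fun z : 'rV[R]_3 => w 0 j * z 0 j) @ u --> w 0 j * u 0 j.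
  exact: cvgM (cvg_cst _) (@coord_continuous R 1 3 0 j u).
exact: cvgD (c _) (cvgD (c _) (cvgD (c _) (cvg_cst _))).
Qed.

(* The sign of this product only depends on the point [Q] of the projective plane. *)
Definition two_line_form l m Q : R := dot (coords l) (coords Q) * dot (coords m) (coords Q).

Lemma two_line_form_pi l m (u : nzvec R) : exists2 a, 0 < a &
  two_line_form l m (\pi_(pplane R) u) =
    a * (dot (coords l) (sval u) * dot (coords m) (sval u)).
Proof.
have [a a0 E] := coords_pi_scale u; exists (a ^+ 2); first by rewrite exprn_even_gt0.
by rewrite /two_line_form E !dotZr; ring.
Qed.

Lemma two_line_form_continuous l m :
  continuous (fun u : nzvec R => dot (coords l) (sval u) * dot (coords m) (sval u)).
Proof.
move=> u; have c w : (fun u : nzvec R => dot w (sval u)) @ u --> dot w (sval u).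
  apply: (@continuous_comp _ _ _ (fun u : nzvec R => sval u : 'rV[R]_3) (dot w)).
    exact: (@initial_continuous _ _ (fun u : nzvec R => sval u : 'rV[R]_3)).
  exact: dot_continuous.
exact: cvgM (c _) (c _).
Qed.

(** Invariance of [S] under positive scaling allows the chosen representative of a point to be
    replaced by any nonzero vector above it, where continuity is available. *)
Lemma open_two_line_form l m (S : set R) : open S ->
  (forall a x, 0 < a -> S (a * x) <-> S x) ->
  @open (quotient_topology (pplane R)) [set Q | S (two_line_form l m Q)].
Proof.
move=> oS SZ; rewrite /open /= /quotient_open.
have -> : \pi_(quotient_topology (pplane R)) @^-1` [set Q | S (two_line_form l m Q)] =
    (fun u : nzvec R => dot (coords l) (sval u) * dot (coords m) (sval u)) @^-1` S.
  apply/seteqP; split=> u /=; have [a a0 E] := two_line_form_pi l m u;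
    by rewrite [two_line_form _ _ _]E => /(SZ _ _ a0).
by apply: open_comp oS => u _; exact: two_line_form_continuous.
Qed.

(** The positivity set is relatively open and closed in [A]. Two lines are needed because a single
    form has no well-defined sign at a projective point. *)
Lemma connected_two_line_form l m (A : set (quotient_topology (pplane R))) P Q :
  connected A -> (forall Q, A Q -> two_line_form l m Q != 0) -> A P -> A Q ->
  0 < two_line_form l m P * two_line_form l m Q.
Proof.
move=> cA A0.
have H P' Q' : A P' -> A Q' -> 0 < two_line_form l m P' -> 0 < two_line_form l m Q'.
  move=> AP AQ P0.
  suff : A `&` [set Q | 0 < two_line_form l m Q] = A by move/seteqP => -[_ /(_ _ AQ)[]].
  apply: cA; first by exists P'.
    exists [set Q | 0 < two_line_form l m Q] => //.
    apply: (@open_two_line_form l m [set x | 0 < x]) => [|a x a0]; first exact: open_gt.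
    by rewrite /= pmulr_rgt0.
  exists (~` [set Q | two_line_form l m Q < 0]).
    rewrite closedC; apply: (@open_two_line_form l m [set x | x < 0]) => [|a x a0].
      exact: open_lt.
    by rewrite /= pmulr_rlt0.
  apply/seteqP; split=> x [Ax /=] h; split=> //=.
    by apply/negP; rewrite -leNgt ltW.
  by rewrite lt_neqAle eq_sym A0 // leNgt; apply/negP.
move=> AP AQ; have P0 := A0 _ AP; have Q0 := A0 _ AQ.
case: (ltrgt0P (two_line_form l m P)) P0 => // hP _.
  by rewrite mulr_gt0 // (H _ _ AP AQ).
rewrite nmulr_rgt0 // lt_neqAle Q0 leNgt; apply/negP => /(H _ _ AQ AP).
by rewrite ltNge ltW.
Qed.

Lemma pi_eq (u : nzvec R) Q : (coords Q == sval u)%MS -> \pi_(pplane R) u = Q.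
Proof.
move=> /eqmxP h; apply: coords_inj; apply/eqmxP.
exact: eqmx_trans (coords_pi u) (eqmx_sym h).
Qed.

Variable L : arrangement R.

Lemma two_line_form_neq0 l m Q : complement L Q -> l \in L -> m \in L ->
  two_line_form l m Q != 0.
Proof. by move=> LQ lL mL; rewrite mulf_neq0 // -on_line_dot LQ. Qed.

Lemma component_path P Q (y : 'rV[R]_3) : L != fset0 -> complement L P ->
  (coords Q == y)%MS ->
  (forall l, l \in L -> 0 < dot (coords l) (coords P) * dot (coords l) y) ->
  @connected_component (quotient_topology (pplane R)) (complement L) P Q.
Proof.
move=> /fset0Pn[l0 l0L] LP Qy xy; set x := coords P in xy.
(* Squares keep both coefficients nonnegative, and not both zero, for every real [t]. The path is
   therefore defined and continuous on the whole line and only then restricted to the unit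
   interval. *)
pose g t := (1 - t) ^+ 2 *: x + t ^+ 2 *: y.
have gx t l : l \in L -> 0 < dot (coords l) x * dot (coords l) (g t).
  move=> lL; rewrite dotDr !dotZr; have := xy l lL.
  have : 0 < dot (coords l) x ^+ 2 by rewrite exprn_even_gt0 //= -on_line_dot LP.
  move: (dot _ x) (dot _ y) => a b; rewrite !expr2 => a2 ab.
  have : 0 < t * t \/ 0 < (1 - t) * (1 - t).
    have [->|t0] := eqVneq t 0; first by right; lra.
    by left; rewrite -expr2 exprn_even_gt0.
  have := sqr_ge0 t; have := sqr_ge0 (1 - t); rewrite !expr2; move: (t * t) ((1 - t) * (1 - t)).
  move=> c d d0 c0 [h|h]; nra.
have g0 t : g t != 0.
  apply/eqP=> E; have := gx t l0 l0L; rewrite E -(scale0r (0 : 'rV[R]_3)) dotZr.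
  by rewrite mul0r mulr0 ltxx.
pose G t : nzvec R := exist _ (g t) (g0 t).
have gc : continuous g.
  move=> t; apply: cvgD; apply: cvgZr_tmp.
    by apply: cvgM; (apply: cvgB; [exact: cvg_cst | exact: cvg_id]).
  by apply: cvgM; exact: cvg_id.
have Gc : continuous (\pi_(quotient_topology (pplane R)) \o G).
  move=> t; apply: continuous_comp; last exact: pi_continuous.
  exact: (@continuous_comp_initial _ _ _ (fun u : nzvec R => sval u : 'rV[R]_3) G gc).
have GP : \pi_(pplane R) (G 0) = P.
  apply: pi_eq; rewrite /= /g subr0 expr1n scale1r expr0n scale0r addr0.
  exact/eqmxP.
have GQ : \pi_(pplane R) (G 1) = Q.
  by apply: pi_eq; rewrite /= /g subrr expr1n scale1r expr0n scale0r add0r.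
pose B := (\pi_(quotient_topology (pplane R)) \o G) @` `[0, 1].
have BQ : B Q by exists 1; rewrite /= ?in_itv /= ?ler01 ?lexx.
apply: (@connected_component_max _ _ B) BQ.
- by exists 0; rewrite /= ?in_itv /= ?ler01 ?lexx.
- move=> _ [t _ <-] l lL; rewrite on_line_dot.
  have [a a0 ->] := coords_pi_scale (G t); rewrite dotZr mulf_neq0 //.
  by apply/eqP=> E; have := gx t l lL; rewrite /= in E *; rewrite E mulr0 ltxx.
- apply: connected_continuous_connected; first exact: segment_connected.
  exact: continuous_subspaceT.
Qed.

End Topology.

(** * Triangular components *)

Section Simplicial.
Variables (R : realType) (L : arrangement R).
Local Open Scope classical_set_scope.

Lemma component_triangle (U : {set L}) P : complement L P -> #|U| = 3%N ->
  nonpencil (@line_vec R L) U ->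
  determines (@line_vec R L) [set: L]%SET U (coords P) ->
  exists2 M : 'M[R]_3, M \in unitmx &
    @connected_component (quotient_topology (pplane R)) (complement L) P = open_triangle M.
Proof.
move=> LP U3 npU dU; set x := coords P in dU.
have [l0 l0U] : exists l, l \in U by apply/set0Pn; rewrite -card_gt0 U3.
have L0 : L != fset0%fset by apply/fset0Pn; exists (val l0); exact: fsvalP.
pose i (k : 'I_3) := enum_val (cast_ord (esym U3) k).
have iP l : l \in U -> exists k, i k = l.
  move=> lU; exists (cast_ord U3 (enum_rank_in lU l)).
  by rewrite /i cast_ordK enum_rankK_in.
pose a (l : L) := dot (line_vec l) x.
have a0 l : a l != 0 by have := LP _ (fsvalP l); rewrite on_line_dot.
(* The rows of [N] are the three equations of the region, made positive at [x]. *)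
pose N := \matrix_k (a (i k) *: line_vec (i k)).
have NE (y : 'rV[R]_3) k : (y *m N^T) 0 k = a (i k) * dot (line_vec (i k)) y.
  by rewrite dotC -dotZr /dot !mxE; apply: eq_bigr => j _; rewrite !mxE.
have NU : N^T \in unitmx.
  rewrite -row_free_unit -kermx_eq0; apply/rowV0P => u /sub_kermxP uN.
  apply: contrapT => /eqP u0; have [l lU] := npU u u0; have [k E] := iP l lU.
  have := NE u k; rewrite uN mxE E => /esym/eqP.
  by rewrite mulf_eq0 (negbTE (a0 l)) /= => ->.
have agreeN y : (forall k, 0 < (y *m N^T) 0 k) <->
    forall l, l \in L -> 0 < dot (coords l) x * dot (coords l) y.
  split=> [yN l lL | yL k]; last by rewrite NE; apply: yL; exact: fsvalP.
  apply: (dU y _ [` lL]%fset); last by rewrite finset.in_setT.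
  by move=> m /iP[k <-]; have := yN k; rewrite NE.
(* The entries of [y *m N^T] are the values of the three equations at [y] and also its coordinates
   in the basis of rows of the inverse, so the cone of positive values is spanned by these rows. *)
exists (invmx N^T); first by rewrite unitmx_inv.
apply/seteqP; split=> Q.
(* The scalar picks, of the two opposite rays above [Q], the one on the same side of [l0] as [x].
   Connectedness carries the agreement to every other line. *)
- move=> PQ; pose y := (a l0 * dot (line_vec l0) (coords Q)) *: coords Q.
  have form l : l \in L -> 0 < two_line_form (val l0) l P * two_line_form (val l0) l Q.
    move=> lL; pose K := @connected_component (quotient_topology (pplane R)) (complement L) P.
    have nz Q' : K Q' -> two_line_form (val l0) l Q' != 0.
      by move=> /connected_component_sub LQ'; apply: two_line_form_neq0 LQ' (fsvalP l0) lL.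
    have PP := @connected_component_refl (quotient_topology (pplane R)) _ _ LP.
    have cK : connected K by exact: component_connected.
    exact: (connected_two_line_form cK nz PP PQ).
  have yL l : l \in L -> 0 < dot (coords l) x * dot (coords l) y.
    move=> lL; suff -> : dot (coords l) x * dot (coords l) y =
        two_line_form (val l0) l P * two_line_form (val l0) l Q by exact: form.
    by rewrite /two_line_form /y dotZr /a /line_vec /x; ring.
  exists (y *m N^T); first exact/agreeN.
  rewrite mulmxK //; apply/eqmxP/eqmx_sym/eqmx_scale; rewrite mulf_neq0 //.
  by have := connected_component_sub PQ _ (fsvalP l0); rewrite on_line_dot.
- case=> c c0 Qc; apply: component_path L0 LP Qc _.
  by apply/agreeN => k; rewrite mulmxKV.
Qed.
End Simplicial.

Local Close Scope ring_scope.

Theorem theoremB (R : realType) (L : arrangement R) :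
  M_arrangement (complexify L) -> ~ pencil L ->
  simplicial L /\
  weak_combinatorics L \in
    [:: (5, 4, 0, 1); (9, 6, 4, 3); (13, 12, 4, 9)].
Proof.
case=> multC4 [m M] npL.
have mult4 P : (2 <= multiplicity L P)%N -> (multiplicity L P <= 4)%N.
  by rewrite -multiplicity_complexify; exact: multC4.
have conf := configuration_arrangement mult4; have mult24 := mult_in_24 mult4.
have np := nonpencil_arrangement npL.
have W : weak_combinatorics L \in [:: (5, 4, 0, 1); (9, 6, 4, 3); (13, 12, 4, 9)].
  rewrite /weak_combinatorics -!(nb_nfold mult4) // cardfE.
  apply: (M_configuration_classification conf mult24 (m := m) np).
  by rewrite !(nb_nfold mult4) // -cardfE -card_complexify -!nfold_complexify.
split=> // P LP.
have E3 : (\sum_p excess (mult_in (@line_vec R L) (@point_vec R L) [set: L]%SET p) = 3)%R.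
  rewrite (sum_excess_mult mult24) !(nb_nfold mult4) //.
  by move: W; rewrite !inE => /or3P[] /eqP[_ -> _ ->].
have xL : {in [set: L]%SET, forall l, dot (line_vec l) (coords P) != 0%R}.
  by move=> l _; have := LP _ (fsvalP l); rewrite on_line_dot.
have [U [_ U3 npU dU]] := melchior_eq conf np E3 xL.
exact: component_triangle LP U3 npU dU.
Qed.
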